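(* Let $c>0$. The image $P_c$, by the rectangular Bercovici–Pata bijection with ratio $0$, of the symmetric Poisson distribution with parameter $c$ is $$P_c=\begin{cases}\dfrac{(4c-(x^2-1-c)^2)^{1/2}}{2\pi|x|}\,\chi_c(x^2)\,dx&\text{if }c\geq1,\\[2mm](1-c)\delta_0+\dfrac{(4c-(x^2-1-c)^2)^{1/2}}{2\pi|x|}\,\chi_c(x^2)\,dx&\text{if }0<c<1,\end{cases}$$ where $\chi_c$ is the characteristic function of $[(1-c^{1/2})^2,(1+c^{1/2})^2]$.
   Context: A symmetric probability measure $\mu$ on $\mathbb{R}$ is $*$-infinitely divisible (for classical convolution $*$) iff there is a (unique) symmetric positive finite measure $G$, called its Lévy measure, with $\int e^{it\xi}d\mu(t)=\exp\left(\int_{\mathbb{R}}(\cos(t\xi)-1)\frac{1+t^2}{t^2}\,dG(t)\right)$ for all $\xi\in\mathbb{R}$. The symmetric Poisson distribution with parameter $c>0$ is the one with Lévy measure $\frac c4(\delta_1+\delta_{-1})$ (the law of $X-Y$ with $X,Y$ independent Poisson variables with parameter $c/2$). Rectangular $R$-transform with ratio $0$. Let $z\mapsto\sqrt z$ be the analytic square root on $\mathbb{C}\setminus[0,+\infty)$ with $\sqrt{-1}=i$; $\arg$ takes values in $[0,2\pi)$; $\Delta_{\alpha,\beta}=\{z: |\arg z-\pi|<\alpha,\ 0<|z|<\beta\}$ for $\alpha\in(0,\pi)$, $\beta>0$. For a symmetric probability measure $\mu$ let $G_\mu(z)=\int\frac{d\mu(t)}{z-t}$ and $H_\mu(z)=\sqrt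 z\,G_\mu(1/\sqrt z)$ for $z\in\mathbb{C}\setminus[0,+\infty)$. There is a (unique germ of) analytic function $H_\mu^{-1}$, defined for every $\alpha\in(0,\pi)$ on $\Delta_{\alpha,\beta}$ for some $\beta>0$, with $H_\mu^{-1}(z)/z\to1$ as $z\to0$ in $\{|\arg z-\pi|<\alpha\}$ and $H_\mu\circ H_\mu^{-1}=H_\mu^{-1}\circ H_\mu=\mathrm{id}$ on such a $\Delta_{\alpha,\beta}$. Then $C_\mu(z)=\frac{z}{H_\mu^{-1}(z)}-1$, and $\mu\mapsto C_\mu$ is injective. The rectangular free convolution $\mu\boxplus_0\nu$ of symmetric probability measures is the unique symmetric probability measure with $C_{\mu\boxplus_0\nu}=C_\mu+C_\nu$; equivalently, its push-forward by $t\mapsto t^2$ is the free convolution of the push-forwards of $\mu$ and $\nu$ by $t\mapsto t^2$. A symmetric probability measure is $\boxplus_0$-infinitely divisible if for each $n\ge1$ it is the $n$-fold $\boxplus_0$-power of some symmetric probability measure. The formula $C_\mu(z)=z\int_{\mathbb{R}}\frac{1+t^2}{1-zt^2}\,dG(t)$ gives a bijection between $\boxplus_0$-infinitely divisible distributions $\mu$ and symmetric positive finite measures $G$ (the Lévy measure of $\mu$). The rectangular Bercovici–Pata bijection with ratio $0$ maps a symmetric $*$-infinitely divisible distribution to the $\boxplus_0$-infinitely divisible distribution with the same Lévy measure; in particular $C_{P_c}(z)=\frac{cz}{1-z}$. *)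

(* Defs.v *)
From HB Require Import structures.
From mathcomp Require Import all_boot all_order all_algebra.
From mathcomp Require Import complex.
From mathcomp Require Import all_classical all_reals all_analysis.

Set Implicit Arguments.
Unset Strict Implicit.
Unset Printing Implicit Defensive.

Import Order.TTheory GRing.Theory Num.Theory.
Import numFieldNormedType.Exports.
Import Normc.

Local Open Scope classical_set_scope.
Local Open Scope ring_scope.
Local Open Scope complex_scope.

Notation finmeasR R := {finite_measure set (measurableTypeR R) -> \bar R}.
Notation probR R := (probability (measurableTypeR R) R).

Section Defs.
Context {R : realType}.
Notation C := R[i].

Definition symmetric_measure
    (mu : {measure set (measurableTypeR R) -> \bar R}) : Prop :=
  forall A : set (measurableTypeR R), measurable A ->
    mu (-%R @^-1` A) = mu A.

Definition cintegral (mu : {measure set (measurableTypeR R) -> \bar R})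
    (f : R -> C) : C :=
  (\int[mu]_t complex.Re (f t)) +i* (\int[mu]_t complex.Im (f t)).

(** * Classical Levy measures *)

(* [(cos (t xi) - 1) (1 + t^2) / t^2], extended by continuity at [t = 0]; the
   convention [0^-1 = 0] would give the wrong value there. *)
Definition levy_kernel (xi t : R) : R :=
  if t == 0 then - (xi ^+ 2 / 2)
  else (cos (t * xi) - 1) * ((1 + t ^+ 2) / t ^+ 2).

(* A symmetric [mu] is infinitely divisible for classical convolution iff such
   a [G] exists; [G] is then unique and is the Levy measure of [mu]. *)
Definition conv_levy_measure (mu : probR R) (G : finmeasR R) : Prop :=
  [/\ symmetric_measure mu, symmetric_measure G &
      forall xi : R,
        cintegral mu (fun t => cos (t * xi) +i* sin (t * xi)) =
        (expR (\int[G]_t levy_kernel xi t))%:C].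

Definition symmetric_poisson (c : R) (mu : probR R) : Prop :=
  exists G : finmeasR R,
    (forall A : set (measurableTypeR R), measurable A ->
      G A = ((c / 4)%:E * (\d_(1%R : R) A + \d_((-1)%R : R) A))%E) /\
    conv_levy_measure mu G.

(** * Rectangular R-transform with ratio 0 *)

(* Argument in [0, 2 pi) of a nonzero complex number. *)
Definition carg (z : C) : R :=
  let theta := acos (complex.Re z / normc z) in
  if 0 <= complex.Im z then theta else 2 * pi - theta.

Definition Delta (alpha beta : R) : set C :=
  [set z | `|carg z - pi| < alpha /\ 0 < normc z < beta].

(* "Near 0 in every sector": [P] holds, for each [alpha] in (0, pi), on
   [Delta alpha beta] for some [beta > 0]. *)
Definition sector_germ (P : C -> Prop) : Prop :=
  forall alpha : R, 0 < alpha < pi ->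
    exists2 beta : R, 0 < beta & forall z, Delta alpha beta z -> P z.

Definition cauchy_transform (mu : probR R) (z : C) : C :=
  cintegral mu (fun t => (z - t%:C)^-1).

(* [sqrtC z] is the square root with nonnegative imaginary part, so on
   C \ [0, +oo) it is the analytic branch with [sqrt (-1) = i]. *)
Definition Htransform (mu : probR R) (z : C) : C :=
  sqrtC z * cauchy_transform mu (sqrtC z)^-1.

(* [h] represents the germ of analytic function H_mu^{-1}. Its values away
   from 0 are irrelevant. *)
Definition Htransform_inverse (mu : probR R) (h : C -> C) : Prop :=
  [/\ sector_germ (fun z => derivable (h : C^o -> C^o) z 1),
      forall eps : R, 0 < eps ->
        sector_germ (fun z => normc (h z / z - 1) < eps),
      sector_germ (fun z => Htransform mu (h z) = z) &
      sector_germ (fun z => h (Htransform mu z) = z)].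

(* [f] represents the germ C_mu. *)
Definition rect_Rtransform (mu : probR R) (f : C -> C) : Prop :=
  symmetric_measure mu /\
  exists2 h, Htransform_inverse mu h &
    sector_germ (fun z => f z = z / h z - 1).

(** * Rectangular free convolution with ratio 0 *)

(* [rho] is the rectangular free convolution of [mu] and [nu]. *)
Definition boxplus0 (mu nu rho : probR R) : Prop :=
  exists f g : C -> C,
    [/\ rect_Rtransform mu f, rect_Rtransform nu g &
        rect_Rtransform rho (fun z => f z + g z)].

Inductive boxplus0_power (nu : probR R) : nat -> probR R -> Prop :=
| boxplus0_power1 : boxplus0_power nu 1 nu
| boxplus0_powerS n rho mu :
    boxplus0_power nu n rho -> boxplus0 rho nu mu ->
    boxplus0_power nu n.+1 mu.

Definition boxplus0_infdiv (mu : probR R) : Prop :=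
  symmetric_measure mu /\
  forall n : nat, (1 <= n)%N ->
    exists nu : probR R, symmetric_measure nu /\ boxplus0_power nu n mu.

Definition boxplus0_levy_measure (mu : probR R) (G : finmeasR R) : Prop :=
  [/\ boxplus0_infdiv mu, symmetric_measure G &
      rect_Rtransform mu (fun z =>
        z * cintegral G
          (fun t => (1 + t%:C ^+ 2) / (1 - z * t%:C ^+ 2)))].

(* Graph of the rectangular Bercovici-Pata bijection with ratio 0: [P] is the
   image of [mu]. *)
Definition bercovici_pata0 (mu P : probR R) : Prop :=
  exists G : finmeasR R,
    conv_levy_measure mu G /\ boxplus0_levy_measure P G.

(** * The explicit distribution *)

Definition Pc_density (c x : R) : R :=
  Num.sqrt (4 * c - (x ^+ 2 - 1 - c) ^+ 2) / (2 * pi * `|x|) *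
  \1_(`[(1 - Num.sqrt c) ^+ 2, (1 + Num.sqrt c) ^+ 2]%classic) (x ^+ 2).

Definition Pc_measure (c : R) (A : set (measurableTypeR R)) : \bar R :=
  let ac := (\int[lebesgue_measure]_(x in A) (Pc_density c x)%:E)%E in
  if 1 <= c then ac else ((1 - c)%R%:E * \d_(0%R : R) A + ac)%E.

End Defs.

(* Main.v *)
(** Existence. Under [x ^+ 2 = 1 + c + 2 * sqrt c * cos t] an integral against
    the explicit density becomes an integral over [0, pi], and everything
    reduces to
      int_0^pi sin^2 t / (1 - 2 q cos t + q^2) dt = pi / 2    (|q| < 1, complex),
    which follows from orthogonality of sines: the functions
    [e_n = sin t (sin ((n+1) t) - q sin (n t)) / (1 - 2 q cos t + q^2)] satisfy
    [e_n - q e_(n+1) = sin t sin ((n+1) t)]. With [s = z / (1 - z)] and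
    [h z = z (1 - z) / (1 - z + c z)] one has
    [1 / h z - x^2 = (1 - 2 q cos t + q^2) / s] for [q = s * sqrt c], so a partial
    fraction decomposition gives [H (h z) = z]. The same transform for [c / n]
    yields infinite divisibility.

    Uniqueness. Integrating the Levy exponent against [exp (- b xi)] shows that
    it determines [int (1 + t^2) / (b^2 + t^2) dG], i.e. the R-transform on the
    negative half-line. There the inverse germ can be solved for explicitly, so
    [int 1 / (Y + t^2) dP] is known for all large [Y]. Writing
    [v = 1 / (Y + t^2)], this determines all moments of [v], and the polynomials
    [(1 - u^n)^(m_n)] with [m_n ~ n / b^n] converge to the indicator of [u < b],
    so a symmetric [P] is determined. *)
Require Import Defs.
From HB Require Import structures.
From mathcomp Require Import all_boot all_order all_algebra.
From mathcomp Require Import complex.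
From mathcomp Require Import all_classical all_reals all_analysis.
From mathcomp Require Import measurable_realfun.
From mathcomp Require Import ring lra.

Set Implicit Arguments.
Unset Strict Implicit.
Unset Printing Implicit Defensive.

Import Order.TTheory GRing.Theory Num.Theory.
Import numFieldNormedType.Exports.
Import Normc.

Local Open Scope classical_set_scope.
Local Open Scope ring_scope.
Local Open Scope complex_scope.

(** * Density and scaled measures *)

(** A measure related to [mu] comes with its own Levy measure and its own inverse germ, of which
    only the defining relations are known. The explicit law must be recovered from them, so both
    passages, exponent to R-transform and R-transform to measure, have to be shown injective.
    Restricting to the negative half-line keeps every quantity in this part real. For existence the
    inverse germ is prescribed: [h] is z / (1 + c z / (1 - z)), which is z divided by one plus the
    wanted R-transform. The variable s = z / (1 - z) is chosen because it factors h as s / ((1 + s)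
    (1 + c s)). The identity H (h z) = z is an integral computation on a small punctured disc; h (H
    w) = w then follows algebraically, since h z = w is a quadratic equation in z with a root small
    enough to lie in that disc. The atom is carried as max (1 - c) 0 and the continuous part has
    mass min 1 c, which is one minus the atom. The atom then cancels from the formula for H, so the
    two cases of the theorem share one computation. *)

Lemma invr_measurable (R : realType) : measurable_fun [set: R] (@GRing.inv R).
Proof.
have -> : [set: R] = [set x | x != 0] `|` [set 0].
  apply/seteqP; split => // x _ /=.
  by have [->|] := eqVneq x 0; [right|left].
have op : open [set x : R | x != 0] by exact: open_neq.
apply/measurable_funU => //; first exact: open_measurable.
split; last exact: measurable_fun_set1.
apply: open_continuous_measurable_fun => // x; rewrite inE /= => x0.
exact: inv_continuous.
Qed.

Lemma measurable_funV d (T : measurableType d) (R : realType) (D : set T)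
    (f : T -> R) :
  measurable_fun D f -> measurable_fun D (fun x => (f x)^-1).
Proof. by move=> mf; apply: measurableT_comp mf; exact: invr_measurable. Qed.

Section density_measure.
Context d (T : measurableType d) (R : realType).
Variables (mu : {measure set T -> \bar R}) (f : T -> R).
Hypotheses (f_ge0 : forall x, 0 <= f x) (mf : measurable_fun setT f).
Local Open Scope ereal_scope.

(** The two proofs are arguments so that the measure instance can be inferred from the term
    itself. *)
Definition density_measure of (forall x, 0 <= f x)%R & measurable_fun setT f :=
  fun A : set T => \int[mu]_(x in A) (f x)%:E.

Local Notation nu := (density_measure f_ge0 mf).

Let nu0 : nu set0 = 0. Proof. exact: integral_set0. Qed.

Let nu_ge0 A : 0 <= nu A.
Proof. by apply: integral_ge0 => x _; rewrite lee_fin. Qed.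

Let nu_sigma_additive : semi_sigma_additive nu.
Proof.
move=> /= F mF tF mUF; rewrite /density_measure; apply: cvg_toP.
  apply: ereal_nondecreasing_is_cvgn => m n mn.
  apply: lee_sum_nneg_natr => // k _ _; apply: integral_ge0 => /= x _.
  by rewrite lee_fin.
rewrite ge0_integral_bigcup//=.
- by apply/measurable_funTS/measurableT_comp.
- by move=> x _; rewrite lee_fin.
Qed.

HB.instance Definition _ := isMeasure.Build _ _ _ nu nu0 nu_ge0
  nu_sigma_additive.

Import HBNNSimple.

Lemma ge0_integral_density (g : T -> \bar R) :
  measurable_fun setT g -> (forall x, 0 <= g x) ->
  \int[nu]_x g x = \int[mu]_x (g x * (f x)%:E).
Proof.
move=> mg g0; pose g_ := nnsfun_approx measurableT mg.
have mEf : measurable_fun setT (EFin \o f) by exact: measurableT_comp.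
transitivity (limn (fun n => \int[nu]_x (g_ n x)%:E)).
  rewrite -monotone_convergence//.
  - apply: eq_integral => y _; apply/esym/cvg_lim => //.
    by apply: cvg_nnsfun_approx.
  - by move=> n; exact/measurable_EFinP.
  - by move=> n y _; rewrite lee_fin.
  - by move=> y _ m n mn; rewrite lee_fin; exact/lefP/nd_nnsfun_approx.
rewrite [X in limn X](_ : _ =
    (fun n => \int[mu]_x ((g_ n x)%:E * (f x)%:E))).
  rewrite -monotone_convergence//; last 3 first.
    - by move=> n /=; apply: emeasurable_funM => //; exact/measurable_EFinP.
    - by move=> n x _ /=; rewrite mule_ge0// lee_fin.
    - move=> x _ m n mn; rewrite lee_wpmul2r// lee_fin//.
      exact/lefP/nd_nnsfun_approx.
  apply: eq_integral => x _; apply/cvg_lim => //; apply: cvgeZr => //.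
  exact: cvg_nnsfun_approx.
apply/funext => n.
(* For a simple function both sides split over its level sets, where the identity is the definition
   of the density measure. *)
transitivity (\sum_(k \in range (g_ n))
    \int[mu]_x ((k * \1_(g_ n @^-1` [set k]) x)%:E * (f x)%:E)); last first.
  rewrite -ge0_integral_fsum//.
  - apply: eq_integral => x _; rewrite -ge0_mule_fsuml//; last first.
      by move=> r; rewrite EFinM nnfun_muleindic_ge0.
    by rewrite fsumEFin// -fimfunE.
  - by move=> r; apply: emeasurable_funM => //; exact/measurable_EFinP/measurable_funM.
  - by move=> r x _; rewrite mule_ge0 ?lee_fin// -lee_fin EFinM nnfun_muleindic_ge0.
under eq_integral do rewrite fimfunE -fsumEFin//.
rewrite ge0_integral_fsum//; last 2 first.
- by move=> y; exact/measurable_EFinP/measurable_funM.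
- by move=> y x _; rewrite nnfun_muleindic_ge0.
apply: eq_fsbigr => r rg; rewrite integralZl_indic_nnsfun// integral_indic//=.
rewrite setIT.
have r0 : (0 <= r)%R by move: rg; rewrite inE => -[x _ <-].
under [RHS]eq_integral do rewrite EFinM -muleA.
rewrite ge0_integralZl//.
- congr (_ * _); rewrite /density_measure integral_mkcond.
  apply: eq_integral => x _; rewrite patchE indicE.
  by case: ifPn => _; rewrite ?mul1e ?mul0e.
- by apply: emeasurable_funM => //; exact/measurable_EFinP.
- by move=> x _; rewrite mule_ge0 ?lee_fin.
Qed.

(** Since [f] is nonnegative, the positive and negative parts of [g * f] are those of [g] times [f],
    so the nonnegative case applies to each part. *)
Lemma integral_density (g : T -> R) : measurable_fun setT g ->
  \int[nu]_x (g x)%:E = \int[mu]_x (g x * f x)%:E.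
Proof.
move=> mg; have mEg : measurable_fun setT (EFin \o g) by exact/measurable_EFinP.
rewrite [LHS]integralE [RHS]integralE.
rewrite !ge0_integral_density//; last 2 first.
- exact: measurable_funeneg.
- exact: measurable_funepos.
congr (_ - _); apply: eq_integral => x _.
- by rewrite !funeposE -!EFin_max -EFinM maxr_pMl// mul0r.
- by rewrite !funenegE -!EFinN -!EFin_max -EFinM maxr_pMl// mul0r mulNr.
Qed.

End density_measure.

Lemma integral_mscale d (T : measurableType d) (R : realType)
    (m : {measure set T -> \bar R}) (k : {nonneg R}) (f : T -> \bar R) :
  m.-integrable setT f ->
  (\int[mscale k m]_x f x = k%:num%:E * \int[m]_x f x)%E.
Proof.
move=> fi; have mf := measurable_int _ fi.
have mp := measurable_funepos mf; have mn := measurable_funeneg mf.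
rewrite [LHS]integralE !ge0_integral_mscale// -muleBr//; first by rewrite -integralE.
have fn := integrable_neg_fin_num measurableT fi.
by rewrite fin_num_adde_defl// fin_numN.
Qed.

Lemma integrable_mscale d (T : measurableType d) (R : realType)
    (m : {measure set T -> \bar R}) (k : {nonneg R}) (f : T -> \bar R) :
  m.-integrable setT f -> (mscale k m).-integrable setT f.
Proof.
move=> fi; have mf := measurable_int _ fi; apply/integrableP; split => //.
rewrite ge0_integral_mscale//; last exact: measurableT_comp.
by have /integrableP[_ ?] := fi; rewrite lte_mul_pinfty.
Qed.

Lemma integrable_dirac d (T : measurableType d) (R : realType) (a : T)
    (f : T -> R) : measurable_fun setT f ->
  (\d_a : {measure set T -> \bar R}).-integrable setT (EFin \o f).
Proof.
move=> mf; have mEf : measurable_fun setT (EFin \o f) by exact/measurable_EFinP.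
apply/integrableP; split => //.
rewrite integral_dirac//; last exact: measurableT_comp.
by rewrite diracT mul1e ltry.
Qed.

(** * Integrals of complex-valued functions *)

Lemma normc_ge0 (R : rcfType) (z : R[i]) : 0 <= normc z.
Proof. by case: z => a b; exact: sqrtr_ge0. Qed.

Lemma normc_real (R : rcfType) (x : R) : normc x%:C = `|x|.
Proof. by rewrite /= expr0n/= addr0 sqrtr_sqr. Qed.

Lemma normc_eq0 (R : rcfType) (z : R[i]) : (normc z == 0) = (z == 0).
Proof.
apply/eqP/eqP => [/eq0_normc//|->].
by rewrite -[0]/((0 : R)%:C) normc_real normr0.
Qed.

Lemma normc_gt0 (R : rcfType) (z : R[i]) : (0 < normc z) = (z != 0).
Proof. by rewrite lt_neqAle normc_ge0 andbT eq_sym normc_eq0. Qed.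

Lemma normcB_ge (R : rcfType) (x y : R[i]) : normc x - normc y <= normc (x - y).
Proof. by rewrite lerBlDr -{1}(subrK y x) le_normcD. Qed.

Lemma normcX (R : rcfType) (z : R[i]) n : normc (z ^+ n) = normc z ^+ n.
Proof.
elim: n => [|n ih]; last by rewrite !exprS normcM ih.
by rewrite !expr0 -[1]/((1 : R)%:C) normc_real normr1.
Qed.

Lemma ler_norm_Re (R : rcfType) (z : R[i]) : `|complex.Re z| <= normc z.
Proof.
case: z => a b /=; rewrite -sqrtr_sqr ler_sqrt ?lerDl ?sqr_ge0//.
by rewrite addr_ge0 ?sqr_ge0.
Qed.

Lemma ler_norm_Im (R : rcfType) (z : R[i]) : `|complex.Im z| <= normc z.
Proof.
case: z => a b /=; rewrite -sqrtr_sqr ler_sqrt ?lerDr ?sqr_ge0//.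
by rewrite addr_ge0 ?sqr_ge0.
Qed.

Lemma normc_le_ReIm (R : rcfType) (z : R[i]) :
  normc z <= `|complex.Re z| + `|complex.Im z|.
Proof.
case: z => a b /=.
rewrite -[leRHS]ger0_norm ?addr_ge0// -[leRHS]sqrtr_sqr ler_sqrt ?sqr_ge0//.
have := mulr_ge0 (normr_ge0 a) (normr_ge0 b).
rewrite sqrrD !real_normK ?num_real//; lra.
Qed.

Section complex_integral.
Context d (T : measurableType d) (R : realType).
Implicit Types (mu : {measure set T -> \bar R}) (D : set T) (f g : T -> R[i]).

Definition Cintegral mu D f : R[i] :=
  (\int[mu]_(x in D) complex.Re (f x)) +i*
  (\int[mu]_(x in D) complex.Im (f x)).

Definition Cmeasurable D f :=
  measurable_fun D (fun x => complex.Re (f x)) /\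
  measurable_fun D (fun x => complex.Im (f x)).

Definition Cbounded D f := exists M : R, forall x, D x -> normc (f x) <= M.

Lemma Cmeasurable_cst D (k : R[i]) : Cmeasurable D (fun=> k).
Proof. by split; exact: measurable_cst. Qed.

Lemma Cmeasurable_real D (r : T -> R) :
  measurable_fun D r -> Cmeasurable D (fun x => (r x)%:C).
Proof. by move=> mr; split => //=; exact: measurable_cst. Qed.

Lemma CmeasurableD D f g : Cmeasurable D f -> Cmeasurable D g ->
  Cmeasurable D (fun x => f x + g x).
Proof.
move=> [mf1 mf2] [mg1 mg2]; split.
- rewrite (_ : (fun x => _) = (fun x => complex.Re (f x) + complex.Re (g x))).
    exact: measurable_funD.
  by apply/funext => x; case: (f x) => ? ?; case: (g x).
- rewrite (_ : (fun x => _) = (fun x => complex.Im (f x) + complex.Im (g x))).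
    exact: measurable_funD.
  by apply/funext => x; case: (f x) => ? ?; case: (g x).
Qed.

Lemma CmeasurableM D f g : Cmeasurable D f -> Cmeasurable D g ->
  Cmeasurable D (fun x => f x * g x).
Proof.
move=> [mf1 mf2] [mg1 mg2]; split.
- rewrite (_ : (fun x => _) = (fun x => complex.Re (f x) * complex.Re (g x) -
    complex.Im (f x) * complex.Im (g x))).
    by apply: measurable_funB; exact: measurable_funM.
  by apply/funext => x; case: (f x) => ? ?; case: (g x).
- rewrite (_ : (fun x => _) = (fun x => complex.Re (f x) * complex.Im (g x) +
    complex.Im (f x) * complex.Re (g x))).
    by apply: measurable_funD; exact: measurable_funM.
  by apply/funext => x; case: (f x) => ? ?; case: (g x).
Qed.

Lemma CmeasurableB D f g : Cmeasurable D f -> Cmeasurable D g ->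
  Cmeasurable D (fun x => f x - g x).
Proof.
move=> mf mg; rewrite (_ : (fun x => _) = (fun x => f x + (-1) * g x)).
  by apply: CmeasurableD => //; apply: CmeasurableM => //; exact: Cmeasurable_cst.
by apply/funext => x; rewrite mulN1r.
Qed.

Lemma CmeasurableV D f : Cmeasurable D f -> Cmeasurable D (fun x => (f x)^-1).
Proof.
move=> [mf1 mf2].
have mn : measurable_fun D
    (fun x => (complex.Re (f x) ^+ 2 + complex.Im (f x) ^+ 2)^-1).
  by apply: measurable_funV; apply: measurable_funD; exact: measurable_funX.
split.
- rewrite (_ : (fun x => _) = (fun x => complex.Re (f x) *
    (complex.Re (f x) ^+ 2 + complex.Im (f x) ^+ 2)^-1)).
    exact: measurable_funM.
  by apply/funext => x; case: (f x).
- rewrite (_ : (fun x => _) = (fun x => - (complex.Im (f x) *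
    (complex.Re (f x) ^+ 2 + complex.Im (f x) ^+ 2)^-1))).
    by apply: measurable_funN; exact: measurable_funM.
  by apply/funext => x; case: (f x).
Qed.

Lemma eq_Cintegral mu D f g :
  (forall x, D x -> f x = g x) -> Cintegral mu D f = Cintegral mu D g.
Proof.
move=> fg; rewrite /Cintegral; congr (_ +i* _);
  by apply: eq_Rintegral => x; rewrite inE => Dx; rewrite fg.
Qed.

Section finite.
Variables (mu : {measure set T -> \bar R}) (D : set T).
Hypotheses (mD : measurable D) (muD : (mu D < +oo)%E).

Lemma integrable_bounded (r : T -> R) (M : R) :
  measurable_fun D r -> (forall x, D x -> `|r x| <= M) ->
  mu.-integrable D (EFin \o r).
Proof.
move=> mr rM; apply: measurable_bounded_integrable => //.
exists M; split; first exact: num_real.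
by move=> y My x Dx; apply: (le_trans (rM x Dx)); exact: ltW.
Qed.

Lemma integrable_Re f : Cmeasurable D f -> Cbounded D f ->
  mu.-integrable D (EFin \o (fun x => complex.Re (f x))).
Proof.
move=> [mf _] [M fM]; apply: (@integrable_bounded _ M) => // x Dx.
by rewrite (le_trans (ler_norm_Re _))// fM.
Qed.

Lemma integrable_Im f : Cmeasurable D f -> Cbounded D f ->
  mu.-integrable D (EFin \o (fun x => complex.Im (f x))).
Proof.
move=> [_ mf] [M fM]; apply: (@integrable_bounded _ M) => // x Dx.
by rewrite (le_trans (ler_norm_Im _))// fM.
Qed.

Lemma CintegralD f g :
  Cmeasurable D f -> Cbounded D f -> Cmeasurable D g -> Cbounded D g ->
  Cintegral mu D (fun x => f x + g x) = Cintegral mu D f + Cintegral mu D g.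
Proof.
move=> mf bf mg bg; rewrite /Cintegral.
under eq_Rintegral do rewrite raddfD.
under [X in _ +i* X]eq_Rintegral do rewrite raddfD.
by rewrite !RintegralD//=; first [exact: integrable_Re|exact: integrable_Im].
Qed.

Lemma CintegralZl (k : R[i]) f : Cmeasurable D f -> Cbounded D f ->
  Cintegral mu D (fun x => k * f x) = k * Cintegral mu D f.
Proof.
move=> mf bf; have iR := integrable_Re mf bf; have iI := integrable_Im mf bf.
have iZ r (h : T -> R) : mu.-integrable D (EFin \o h) ->
    mu.-integrable D (EFin \o (fun x => r * h x)).
  move=> ih; rewrite (_ : _ \o _ = fun x => (r%:E * (h x)%:E)%E).
    exact: integrableZl.
  by apply/funext => x; rewrite /= EFinM.
case: k => a b; rewrite /Cintegral.
transitivity (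
    (\int[mu]_(x in D) (a * complex.Re (f x) - b * complex.Im (f x))) +i*
    (\int[mu]_(x in D) (a * complex.Im (f x) + b * complex.Re (f x)))).
  by congr (_ +i* _); apply: eq_Rintegral => x _; case: (f x).
rewrite RintegralB ?RintegralD ?RintegralZl//; by exact: iZ.
Qed.

(** Real and imaginary parts are estimated separately, hence the factor 2; its use below only asks
    for some uniform bound. *)
Lemma normc_Cintegral_le f M : Cmeasurable D f ->
  (forall x, D x -> normc (f x) <= M) ->
  normc (Cintegral mu D f) <= (M * fine (mu D)) *+ 2.
Proof.
move=> mf fM; have bf : Cbounded D f by exists M.
have H (r : T -> R) : mu.-integrable D (EFin \o r) ->
    (forall x, D x -> `|r x| <= M) ->
    `|\int[mu]_(x in D) r x| <= M * fine (mu D).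
  move=> ir rM; rewrite (le_trans (le_normr_Rintegral mD ir))//.
  rewrite -Rintegral_cst// le_Rintegral//.
  - exact: integrable_norm.
  - by apply: (@integrable_bounded (fun=> M) `|M|).
rewrite (le_trans (normc_le_ReIm _))// mulr2n lerD//= H//.
- exact: integrable_Re.
- by move=> x Dx; rewrite (le_trans (ler_norm_Re _))// fM.
- exact: integrable_Im.
- by move=> x Dx; rewrite (le_trans (ler_norm_Im _))// fM.
Qed.

End finite.

Lemma Cintegral_real mu D (r : T -> R) :
  Cintegral mu D (fun x => (r x)%:C) = (\int[mu]_(x in D) r x)%:C.
Proof. by rewrite /Cintegral /= /Rintegral integral0. Qed.

End complex_integral.

(** * Trigonometric integrals *)

Lemma le0_geometric (R : realType) (x r K : R) :
  `|r| < 1 -> (forall n, x <= r ^+ n * K) -> x <= 0.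
Proof.
move=> r1 xK; have : (r ^+ n * K) @[n --> \oo] --> (0 * K : R).
  by apply: cvgMl; exact: cvg_expr.
by rewrite mul0r => /cvg_lim <- //; apply: limr_ge;
  [apply/cvg_ex; exists (0 * K); apply: cvgMl; exact: cvg_expr|exact: nearW].
Qed.

Lemma is_derive_continuous (R : realType) (F f : R -> R) :
  (forall x : R, is_derive x 1 F (f x)) -> continuous F.
Proof.
move=> dF x; apply: differentiable_continuous; apply/derivable1_diffP.
by have [] := dF x.
Qed.

Lemma FTC2_is_derive (R : realType) (F f : R -> R) (a b : R) : a < b ->
  (forall x : R, is_derive x 1 F (f x)) -> continuous f ->
  (\int[lebesgue_measure]_(x in `[a, b]) (f x)%:E = (F b - F a)%:E)%E.
Proof.
move=> ab dF cf; have cF := is_derive_continuous dF.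
rewrite (@continuous_FTC2 _ f F a b) ?EFinB//.
- exact: continuous_subspaceT.
- split.
  + by move=> x _; have [] := dF x.
  + exact/cvg_at_right_filter/cF.
  + exact/cvg_at_left_filter/cF.
- by move=> x _; rewrite derive1E; have [_ ->] := dF x.
Qed.

Section trigonometric_integrals.
Variable R : realType.
Local Notation mu := (@lebesgue_measure R).

Lemma sin_natMpi n : sin (n%:R * pi) = 0 :> R.
Proof.
elim: n => [|n ih]; first by rewrite mul0r sin0.
by rewrite -natr1 mulrDl mul1r sinD ih sinpi mul0r mulr0 addr0.
Qed.

Lemma lebesgue_itv0pi : mu `[0, pi] = pi%:E :> \bar R.
Proof.
by rewrite lebesgue_measure_itv/= lte_fin pi_gt0 oppr0 adde0.
Qed.

Lemma is_derive_sinM (k x : R) :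
  is_derive x 1 (fun t => sin (k * t)) (k * cos (k * x)).
Proof. by apply: is_derive_eq; rewrite /GRing.scale/=; ring. Qed.

Lemma is_derive_cosM (k x : R) :
  is_derive x 1 (fun t => cos (k * t)) (- (k * sin (k * x))).
Proof. by apply: is_derive_eq; rewrite /GRing.scale/=; ring. Qed.

Lemma integral_cosn n :
  \int[mu]_(t in `[0, pi]) cos (n%:R * t) = if n == 0%N then pi else 0 :> R.
Proof.
case: n => [|n] /=.
  under eq_Rintegral do rewrite mul0r cos0.
  by rewrite Rintegral_cst// mul1r -[RHS]/(fine pi%:E); congr fine; exact: lebesgue_itv0pi.
have n0 : (n.+1%:R : R) != 0 by rewrite pnatr_eq0.
have dF (x : R) : is_derive x 1 (fun t => n.+1%:R^-1 * sin (n.+1%:R * t))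
    (cos (n.+1%:R * x)).
  have dx := is_derive_sinM n.+1%:R x.
  by apply: is_derive_eq; rewrite /GRing.scale/= mulKf.
rewrite /Rintegral (FTC2_is_derive (pi_gt0 R) dF).
  by rewrite sin_natMpi !mulr0 sin0 mulr0 subr0.
by apply: is_derive_continuous => x; exact: is_derive_cosM.
Qed.

End trigonometric_integrals.

(** * The Poisson kernel integral for complex q *)

Section poisson_kernel.
Variables (R : realType) (q : R[i]).
Hypothesis q1 : normc q < 1.
Local Notation mu := (@lebesgue_measure R).

Definition poisson_denom (t : measurableTypeR R) : R[i] := 1 - q * (2 * cos t)%:C + q ^+ 2.
Local Notation B := poisson_denom.

(** The denominator factors as (1 - q e^(it)) (1 - q e^(-it)), and each factor has modulus at least
    1 - |q|. In the proof [u] and [v] are the two exponentials. *)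
Lemma normc_poisson_denom_ge t : (1 - normc q) ^+ 2 <= normc (B t).
Proof.
pose u := cos t +i* sin t; pose v := cos t +i* (- sin t).
have uDv : u + v = (2 * cos t)%:C.
  by apply/eqP; rewrite eq_complex /=; apply/andP; split; apply/eqP; ring.
have uMv : u * v = 1.
  apply/eqP; rewrite eq_complex /=; apply/andP; split; apply/eqP; last by ring.
  by rewrite -(cos2Dsin2 t); ring.
have nu : normc u = 1 by rewrite /= cos2Dsin2 sqrtr1.
have nv : normc v = 1 by rewrite /= sqrrN cos2Dsin2 sqrtr1.
have -> : B t = (1 - q * u) * (1 - q * v).
  rewrite (_ : _ * _ = 1 - q * (u + v) + q ^+ 2 * (u * v)); last by ring.
  by rewrite uDv uMv mulr1.
have n1 : normc (1 : R[i]) = 1 by rewrite -[1]/((1 : R)%:C) normc_real normr1.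
have H w : normc w = 1 -> 1 - normc q <= normc (1 - q * w).
  by move=> nw; rewrite (le_trans _ (normcB_ge _ _))// normcM nw mulr1 n1.
rewrite normcM expr2 ler_pM ?H// subr_ge0; exact: ltW.
Qed.

Lemma poisson_denom_neq0 t : B t != 0.
Proof.
rewrite -normc_gt0 (lt_le_trans _ (normc_poisson_denom_ge t))//.
by rewrite exprn_gt0// subr_gt0.
Qed.

Lemma normc_poisson_denomV_le t : normc (B t)^-1 <= ((1 - normc q) ^+ 2)^-1.
Proof.
rewrite normcV lef_pV2 ?normc_poisson_denom_ge// posrE.
- by rewrite normc_gt0 poisson_denom_neq0.
- by rewrite exprn_gt0// subr_gt0.
Qed.

Lemma Cmeasurable_poisson_denom (D : set (measurableTypeR R)) : Cmeasurable D B.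
Proof.
apply: CmeasurableD; last exact: Cmeasurable_cst.
apply: CmeasurableB; first exact: Cmeasurable_cst.
apply: CmeasurableM; first exact: Cmeasurable_cst.
apply: Cmeasurable_real; apply: measurable_funTS; apply: measurable_funM => //.
apply: continuous_measurable_fun; exact: continuous_cos.
Qed.

Let e n (t : measurableTypeR R) : R[i] := (sin t)%:C *
  ((sin (n.+1%:R * t))%:C - q * (sin (n%:R * t))%:C) * (B t)^-1.

Let measurable_sinM (k : R) (D : set (measurableTypeR R)) :
  measurable_fun D (fun t : measurableTypeR R => sin (k * t)).
Proof.
apply: measurable_funTS; apply: continuous_measurable_fun.
exact: is_derive_continuous.
Qed.

Let Cmeasurable_e n (D : set (measurableTypeR R)) : Cmeasurable D (e n).
Proof.
apply: CmeasurableM; last by apply: CmeasurableV; exact: Cmeasurable_poisson_denom.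
apply: CmeasurableM.
  apply: Cmeasurable_real; apply: measurable_funTS.
  by apply: continuous_measurable_fun; exact: continuous_sin.
apply: CmeasurableB; first by apply: Cmeasurable_real; exact: measurable_sinM.
apply: CmeasurableM; first exact: Cmeasurable_cst.
by apply: Cmeasurable_real; exact: measurable_sinM.
Qed.

Let K := (1 * (1 + 1)) * ((1 - normc q) ^+ 2)^-1.

Let normc_e n t : normc (e n t) <= K.
Proof.
rewrite /e /K !normcM ler_pM ?mulr_ge0 ?normc_ge0//; last first.
  exact: normc_poisson_denomV_le.
rewrite ler_pM ?normc_ge0//; first by rewrite normc_real sin_max.
rewrite (le_trans (le_normcD _ _))// normcN lerD//.
  by rewrite normc_real sin_max.
by rewrite normcM normc_real mulr_ile1// ?normc_ge0 ?sin_max ?ltW.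
Qed.

Let Cbounded_e n (D : set (measurableTypeR R)) : Cbounded D (e n).
Proof. by exists K => t _. Qed.

Let e_rec n t :
  e n t - q * e n.+1 t = (sin t * sin (n.+1%:R * t))%:C.
Proof.
have H : sin (n.+2%:R * t) = 2 * cos t * sin (n.+1%:R * t) - sin (n%:R * t).
  rewrite (_ : n.+2%:R * t = n.+1%:R * t + t); last by rewrite -natr1; ring.
  rewrite (_ : n%:R * t = n.+1%:R * t - t); last by rewrite -natr1; ring.
  by rewrite sinB sinD; ring.
apply: (mulIf (poisson_denom_neq0 t)).
rewrite /e mulrBl mulfVK ?poisson_denom_neq0// !mulrA mulfVK ?poisson_denom_neq0//.
by rewrite H /B; rewrite !(rmorphM, rmorphB)/=; ring.
Qed.

Let J n := Cintegral mu `[0, pi] (e n).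

Let mu_fin : (mu `[0%R, pi] < +oo)%E.
Proof. by rewrite lebesgue_itv0pi ltry. Qed.

(** Integrated form of [e_rec]: sin t sin ((n+1) t) is half of cos (n t) - cos ((n+2) t), whose
    integral over [0, pi] vanishes unless n = 0. *)
Let J_rec n : J n - q * J n.+1 = if n == 0%N then (pi / 2)%:C else 0.
Proof.
rewrite /J -mulNr -CintegralZl//. rewrite -CintegralD//; last 2 first.
- by apply: CmeasurableM => //; exact: Cmeasurable_cst.
- exists (normc (- q) * K) => t _.
  by rewrite normcM ler_wpM2l// normc_ge0.
rewrite (@eq_Cintegral _ _ _ _ _ _
    (fun t : measurableTypeR R => (sin t * sin (n.+1%:R * t))%:C)); last first.
  by move=> t _; rewrite mulNr e_rec.
rewrite Cintegral_real.
have icos m (k : R) : mu.-integrable `[0, pi]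
    (EFin \o (fun t : measurableTypeR R => cos (m%:R * t) * k)).
  apply: (@integrable_bounded _ _ _ _ _ _ _ _ `|k|) => //.
    apply: measurable_funM => //.
    apply: measurable_funTS; apply: continuous_measurable_fun.
exact: is_derive_continuous.
  by move=> t _; rewrite normrM ler_piMl ?cos_max.
rewrite (@eq_Rintegral _ _ _ _ _
    (fun t : measurableTypeR R => cos (n%:R * t) * 2^-1 - cos (n.+2%:R * t) * 2^-1)); last first.
  move=> t _.
  rewrite (_ : n.+2%:R * t = n.+1%:R * t + t); last by rewrite -natr1; ring.
  rewrite (_ : n%:R * t = n.+1%:R * t - t); last by rewrite -natr1; ring.
  by rewrite cosB cosD; field.
have icos1 m : mu.-integrable `[0, pi]
    (EFin \o (fun t : measurableTypeR R => cos (m%:R * t))).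
  rewrite (_ : _ \o _ = EFin \o (fun t => cos (m%:R * t) * 1)) //.
  by apply/funext => t /=; rewrite mulr1.
rewrite RintegralB// !RintegralZr//.
by rewrite !integral_cosn/= mul0r subr0; case: n; rewrite //= mul0r.
Qed.

(** The integrand is the function [e 0]. Iterating the recurrence gives J_1 = q^n J_(n+1) with all J
    bounded by one constant, so J_1 = 0 and J_0 = pi / 2. *)
Lemma Cintegral_sinX2_div_poisson_denom :
  Cintegral mu `[0, pi] (fun t : measurableTypeR R => (sin t ^+ 2)%:C / B t) = (pi / 2)%:C.
Proof.
have -> : Cintegral mu `[0, pi] (fun t : measurableTypeR R => (sin t ^+ 2)%:C / B t) = J 0.
  apply: eq_Cintegral => t _; rewrite /e mul1r mul0r sin0 mulr0 subr0.
  by rewrite -rmorphM expr2.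
have J1 n : J 1 = q ^+ n * J n.+1.
  elim: n => [|n ->]; first by rewrite mul1r.
  have /eqP := J_rec n.+1; rewrite subr_eq add0r => /eqP ->.
  by rewrite exprSr mulrA.
have {}J1 : J 1 = 0.
  apply/eqP; rewrite -normc_eq0 eq_le normc_ge0 andbT.
  apply: (@le0_geometric _ _ (normc q) ((K * pi) *+ 2)).
    by rewrite ger0_norm ?normc_ge0.
  move=> n; rewrite (J1 n) normcM normcX ler_wpM2l ?exprn_ge0 ?normc_ge0//.
  have -> : pi = fine (mu `[0, pi]) :> R by rewrite lebesgue_itv0pi.
  by apply: normc_Cintegral_le.
have /eqP := J_rec 0; rewrite subr_eq J1 mulr0 addr0 => /eqP.
exact.
Qed.

End poisson_kernel.

(** * The change of variable [x ^+ 2 = 1 + c + 2 * sqrt c * cos t] *)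

Section Pc_substitution.
Variables (R : realType) (c : R).
Hypothesis c_gt0 : 0 < c.
Local Notation mu := (@lebesgue_measure R).
Local Notation a := (Num.sqrt c).

Let a_gt0 : 0 < a. Proof. by rewrite sqrtr_gt0. Qed.
Let aa : a ^+ 2 = c. Proof. by rewrite sqr_sqrtr// ltW. Qed.

Lemma Pc_density_ge0 x : 0 <= Pc_density c x.
Proof.
by rewrite /Pc_density mulr_ge0// divr_ge0 ?sqrtr_ge0// !mulr_ge0// pi_ge0.
Qed.

Lemma Pc_densityN x : Pc_density c (- x) = Pc_density c x.
Proof. by rewrite /Pc_density sqrrN normrN. Qed.

Lemma measurable_Pc_density : measurable_fun [set: measurableTypeR R] (Pc_density c).
Proof.
have mX : measurable_fun [set: measurableTypeR R] (fun x : R => x ^+ 2).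
  exact: measurable_funX.
apply: measurable_funM.
  apply: measurable_funM.
    apply: measurableT_comp.
      by apply: continuous_measurable_fun; exact: sqrt_continuous.
    apply: measurable_funB => //; apply: measurable_funX.
    by apply: measurable_funB => //; exact: measurable_funB.
  by apply: measurable_funV; exact: measurable_funM.
by apply: measurableT_comp mX; exact: measurable_indic.
Qed.

(** The edge is included because the square root vanishes there. The support in |x| is thus open on
    the left, which keeps x = 0 out even when c = 1. *)
Lemma Pc_density_eq0l x : x ^+ 2 <= (1 - a) ^+ 2 -> Pc_density c x = 0.
Proof.
rewrite le_eqVlt => /predU1P[xa|xa].
  rewrite /Pc_density (_ : 4 * c - _ = 0) ?sqrtr0 ?mul0r//.
  by rewrite xa; move: aa; set b := a => <-; ring.
rewrite /Pc_density indicE memNset ?mulr0//= in_itv/= => /andP[].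
by rewrite leNgt xa.
Qed.

Lemma Pc_density_eq0r x : (1 + a) ^+ 2 < x ^+ 2 -> Pc_density c x = 0.
Proof.
move=> xa; rewrite /Pc_density indicE memNset ?mulr0//= in_itv/= => /andP[_].
by rewrite leNgt xa.
Qed.

Lemma Pc_density_supp x :
  Pc_density c x != 0 -> `|1 - a| < `|x| <= 1 + a.
Proof.
move=> dx; apply/andP; split.
- rewrite ltNge; apply: contraNN dx => xa.
  apply/eqP/Pc_density_eq0l; rewrite -[x ^+ 2]real_normK ?num_real//.
  by rewrite -[leRHS]real_normK ?num_real// ler_sqr ?nnegrE.
- rewrite leNgt; apply: contraNN dx => xa.
  apply/eqP/Pc_density_eq0r; rewrite -[x ^+ 2]real_normK ?num_real//.
  by rewrite ltr_sqr ?nnegrE// addr_ge0// ltW.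
Qed.

Definition Pc_angle_sqr (t : R) := 1 + c + 2 * a * cos t.
Local Notation X := Pc_angle_sqr.
Definition Pc_angle (t : R) := Num.sqrt (X t).
Local Notation F := Pc_angle.

(* the image of the density under the change of variable
   [x ^+ 2 = 1 + c + 2 * sqrt c * cos t] *)
Definition Pc_angle_density (t : R) := c * sin t ^+ 2 / (pi * X t).
Local Notation rho := Pc_angle_density.

Lemma Pc_angle_sqrE t : X t = (1 - a) ^+ 2 + 2 * a * (1 + cos t).
Proof. by rewrite /X; move: aa; set b := a => <-; ring. Qed.

Lemma Pc_angle_sqr_ge0 t : 0 <= X t.
Proof.
by rewrite Pc_angle_sqrE addr_ge0 ?sqr_ge0// mulr_ge0 ?mulr_ge0 ?sqrtr_ge0.
Qed.

Lemma cos_gtN1 (t : R) : t \in `]0, pi[ -> -1 < cos t.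
Proof.
rewrite in_itv/= => /andP[t0 tpi]; rewrite -cospi ltr_cos// in_itv/= ?pi_ge0 ?lexx//.
by rewrite (ltW t0) (ltW tpi).
Qed.

Lemma Pc_angle_sqr_gt0 t : t \in `]0, pi[ -> 0 < X t.
Proof.
move=> t0; rewrite Pc_angle_sqrE ltr_wpDl ?sqr_ge0// mulr_gt0 ?mulr_gt0//.
by rewrite -ltrBlDl sub0r cos_gtN1.
Qed.

Lemma sqr_Pc_angle t : F t ^+ 2 = X t.
Proof. by rewrite sqr_sqrtr// Pc_angle_sqr_ge0. Qed.

Lemma Pc_angle_ge0 t : 0 <= F t. Proof. exact: sqrtr_ge0. Qed.

Lemma Pc_angle_gt0 t : t \in `]0, pi[ -> 0 < F t.
Proof. by move=> /Pc_angle_sqr_gt0; rewrite sqrtr_gt0. Qed.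

Lemma Pc_angle0 : F 0 = 1 + a.
Proof.
rewrite /F /X cos0 (_ : 1 + c + _ = (1 + a) ^+ 2); last first.
  by move: aa; set b := a => <-; ring.
by rewrite sqrtr_sqr ger0_norm// addr_ge0// ltW.
Qed.

Lemma Pc_anglepi : F pi = `|1 - a|.
Proof.
rewrite /F /X cospi (_ : 1 + c + _ = (1 - a) ^+ 2); last first.
  by move: aa; set b := a => <-; ring.
by rewrite sqrtr_sqr.
Qed.

Lemma Pc_angle_le t : F t <= 1 + a.
Proof.
rewrite -Pc_angle0 ler_wsqrtr// lerD2l ler_pM2l ?mulr_gt0// cos0.
exact: cos_le1.
Qed.

Lemma continuous_Pc_angle : continuous F.
Proof.
move=> t; apply: (@continuous_comp _ _ _ X Num.sqrt); last exact: sqrt_continuous.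
by apply: differentiable_continuous; apply/derivable1_diffP.
Qed.

Lemma is_derive_Pc_angle (t : R) : t \in `]0, pi[ ->
  is_derive t 1 F (- (a * sin t) / F t).
Proof.
move=> t0; have dX : is_derive t 1 X (- (2 * a * sin t)).
  by apply: is_derive_eq; rewrite /GRing.scale/=; ring.
have dS := is_derive1_sqrt (Pc_angle_sqr_gt0 t0).
have := is_derive1_comp dS dX; rewrite -/(F t).
rewrite (_ : _^-1 * _ = - (a * sin t) / F t)//; field.
by rewrite gt_eqF// Pc_angle_gt0.
Qed.

Lemma Pc_angle_density_ge0 t : 0 <= rho t.
Proof.
have c0 := ltW c_gt0; have X0 := Pc_angle_sqr_ge0 t.
by apply: divr_ge0; apply: mulr_ge0; rewrite ?sqr_ge0 ?pi_ge0.
Qed.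

(** The difference X - c sin^2 t is the square (1 + sqrt c cos t)^2. This bounds [rho] up to t = pi
    also when c = 1, where X vanishes at pi. *)
Lemma Pc_angle_density_le t : rho t <= pi^-1.
Proof.
have [X0|X0] := eqVneq (X t) 0.
  by rewrite /rho X0 mulr0 invr0 mulr0 invr_ge0 pi_ge0.
have Xgt0 : 0 < X t by rewrite lt_neqAle eq_sym X0 Pc_angle_sqr_ge0.
rewrite /rho invfM mulrCA -[leRHS]mulr1 ler_pM2l ?invr_gt0 ?pi_gt0//.
rewrite ler_pdivrMr// mul1r -subr_ge0 sin2cos2.
rewrite (_ : _ - _ = (1 + a * cos t) ^+ 2) ?sqr_ge0//.
by rewrite /X; move: aa; set b := a => <-; ring.
Qed.

Lemma measurable_Pc_angle_sqr : measurable_fun [set: measurableTypeR R] X.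
Proof.
apply: continuous_measurable_fun => t.
by apply: differentiable_continuous; apply/derivable1_diffP.
Qed.

Lemma measurable_Pc_angle : measurable_fun [set: measurableTypeR R] F.
Proof. by apply: continuous_measurable_fun; exact: continuous_Pc_angle. Qed.

Lemma measurable_Pc_angle_density : measurable_fun [set: measurableTypeR R] rho.
Proof.
apply: measurable_funM.
  apply: measurable_funM => //; apply: measurable_funX.
  by apply: continuous_measurable_fun; exact: continuous_sin.
by apply: measurable_funV; apply: measurable_funM => //; exact: measurable_Pc_angle_sqr.
Qed.

End Pc_substitution.

Section Pc_substitution_integral.
Variables (R : realType) (c : R).
Hypothesis c_gt0 : 0 < c.
Local Notation mu := (@lebesgue_measure R).
Local Notation a := (Num.sqrt c).
Local Notation F := (Pc_angle c).
Local Notation rho := (Pc_angle_density c).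

Let a_gt0 : 0 < a. Proof. by rewrite sqrtr_gt0. Qed.
Let aa : a ^+ 2 = c. Proof. by rewrite sqr_sqrtr// ltW. Qed.

Let f t := - (a * sin t) / F t.

Let dFE : {in `]0, pi[, (derive1 F) =1 f}.
Proof.
by move=> t t0; rewrite derive1E; have [_ ->] := is_derive_Pc_angle c_gt0 t0.
Qed.

Let cf t : F t != 0 -> {for t, continuous f}.
Proof.
move=> Ft0; apply: (@continuousM _ _ (fun t => - (a * sin t)) (fun t => (F t)^-1)).
  by apply: differentiable_continuous; apply/derivable1_diffP.
by apply: continuousV => //; exact: continuous_Pc_angle.
Qed.

Let cdF : {in `]0, pi[, continuous (derive1 F)}.
Proof.
move=> t t0; rewrite /continuous_at (dFE t0).
have Ft0 : F t != 0 by rewrite gt_eqF// Pc_angle_gt0.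
have := cf Ft0; apply: cvg_trans; apply: near_eq_cvg.
apply: (@open_in_nearW _ _ `]0, pi[); last by rewrite inE.
  exact: interval_open.
by move=> z; rewrite inE/= => z0; rewrite dFE.
Qed.

Let sqrt_neq1 : c != 1 -> 1 - a != 0.
Proof.
by apply: contra => /eqP/subr0_eq a1; rewrite -aa -a1 expr1n.
Qed.

Let cvg_dF_right : cvg (derive1 F x @[x --> 0^'+]).
Proof.
apply/cvg_ex; exists (f 0).
have F0 : F 0 != 0 by rewrite Pc_angle0// gt_eqF// addr_gt0.
have := cvg_at_right_filter (cf F0); apply: cvg_trans; apply: near_eq_cvg.
near=> t; rewrite dFE// in_itv/=; apply/andP; split => //.
by near: t; apply: nbhs_right_lt; exact: pi_gt0.
Unshelve. all: by end_near. Qed.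

Let cvg_dF_left : cvg (derive1 F x @[x --> pi^'-]).
Proof.
have near0pi : \forall t \near (@pi R)^'-, t \in `]0, pi[.
  near=> t; rewrite in_itv/=; apply/andP; split => //.
  by near: t; apply: nbhs_left_gt; exact: pi_gt0.
(* The substitution theorem asks for a limit of F' at pi. For c = 1 the formula for F' is 0 / 0
   there; the half-angle form F = 2 cos (t / 2) turns it into - sin (t / 2). *)
have [c1|c1] := eqVneq c 1.
  apply/cvg_ex; exists (- sin (2^-1 * pi)).
  have cs : {for pi, continuous (fun t : R => - sin (2^-1 * t))}.
    by apply: differentiable_continuous; apply/derivable1_diffP.
  have := cvg_at_left_filter cs; apply: cvg_trans; apply: near_eq_cvg.
  apply: filterS near0pi => t t0; rewrite dFE// /f.
  have tE : t = (2^-1 * t) *+ 2 by rewrite -mulr_natr; field.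
  have [th th2] : 0 < 2^-1 * t /\ 2^-1 * t < pi / 2.
    by move: t0; rewrite in_itv/= => /andP[? ?]; lra.
  have ct : 0 < cos (2^-1 * t).
    by apply: cos_gt0_pihalf; rewrite th2 andbT (lt_trans _ th)// oppr_lt0 divr_gt0// pi_gt0.
  have -> : F t = 2 * cos (2^-1 * t).
    rewrite /Pc_angle /Pc_angle_sqr c1 sqrtr1 {1}tE cos_mulr2n.
    rewrite (_ : _ + _ = (2 * cos (2^-1 * t)) ^+ 2); last by ring.
    by rewrite sqrtr_sqr ger0_norm// mulr_ge0// ltW.
  rewrite c1 sqrtr1 {2}tE sin_mulr2n; field.
  exact: lt0r_neq0.
apply/cvg_ex; exists (f pi).
have Fpi : F pi != 0 by rewrite Pc_anglepi// normr_eq0 sqrt_neq1.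
have := cvg_at_left_filter (cf Fpi); apply: cvg_trans; apply: near_eq_cvg.
by apply: filterS near0pi => t t0; rewrite dFE.
Unshelve. all: by end_near. Qed.

Let derivable_F : derivable_oo_LRcontinuous F 0 pi.
Proof.
split.
- by move=> t t0; have [] := is_derive_Pc_angle c_gt0 t0.
- exact/cvg_at_right_filter/continuous_Pc_angle.
- exact/cvg_at_left_filter/continuous_Pc_angle.
Qed.

Let decreasing_F : {in `[0, pi] &, {homo F : x y /~ x < y}}.
Proof.
move=> y x y0 x0 xy; rewrite /Pc_angle ltr_sqrt; last first.
  rewrite (le_lt_trans (Pc_angle_sqr_ge0 c_gt0 y))//.
  by rewrite /Pc_angle_sqr ltrD2l ltr_pM2l ?mulr_gt0// ltr_cos.
by rewrite /Pc_angle_sqr ltrD2l ltr_pM2l ?mulr_gt0// ltr_cos.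
Qed.

(* [Pc_density c] extended by continuity at the lower end [`|1 - a|] of its
   support, which is [0] when [c = 1] *)
Let g x := if c == 1 then Num.sqrt (4 - x ^+ 2) / (2 * pi) else
  Num.sqrt (4 * c - (x ^+ 2 - 1 - c) ^+ 2) / (2 * pi * x).

Let gE (x : R) : `|1 - a| < x <= 1 + a -> Pc_density c x = g x.
Proof.
move=> /andP[x0 xa]; have {}x0' : 0 < x by rewrite (le_lt_trans _ x0).
rewrite /Pc_density indicE mem_set/=; last first.
  rewrite in_itv/=; apply/andP; split.
    by rewrite -[leLHS]real_normK ?num_real// ler_sqr ?nnegrE ?normr_ge0 ?(ltW x0) ?(ltW x0').
  by rewrite ler_sqr ?nnegrE ?addr_ge0 ?(ltW x0') ?(ltW a_gt0).
rewrite mulr1 gtr0_norm// /g; case: ifPn => // /eqP c1.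
rewrite c1 (_ : 4 * 1 - _ = x ^+ 2 * (4 - x ^+ 2)); last by ring.
rewrite sqrtrM ?sqr_ge0// sqrtr_sqr gtr0_norm//.
have pn0 : (pi : R) != 0 by rewrite gt_eqF ?pi_gt0.
have xn0 : x != 0 by rewrite gt_eqF.
by move: (@pi R) pn0 => p pn0; field; rewrite pn0.
Qed.

Let gF (t : R) : t \in `]0, pi[ -> g (F t) * f t = - rho t.
Proof.
move=> t0; have Ft0 := Pc_angle_gt0 c_gt0 t0.
have [t0' tpi] : 0 <= t /\ t <= pi.
  by move: t0; rewrite in_itv/= => /andP[/ltW ? /ltW ?].
rewrite -gE; last first.
  rewrite -(Pc_anglepi c_gt0) Pc_angle_le// andbT; apply: decreasing_F.
  - by rewrite in_itv/= pi_ge0 lexx.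
  - by rewrite in_itv/= t0' tpi.
  - by move: t0; rewrite in_itv/= => /andP[].
rewrite /Pc_density indicE mem_set/=; last first.
  rewrite in_itv/= sqr_Pc_angle// Pc_angle_sqrE//; apply/andP; split.
    rewrite lerDl; apply: mulr_ge0; first by rewrite mulr_ge0 ?sqrtr_ge0.
    by rewrite -lerBlDl sub0r cos_geN1.
  rewrite -subr_ge0 (_ : _ - _ = 2 * a * (1 - cos t)); last by ring.
  apply: mulr_ge0; first by rewrite mulr_ge0 ?sqrtr_ge0.
  by rewrite subr_ge0 cos_le1.
rewrite mulr1 gtr0_norm// sqr_Pc_angle//.
have -> : 4 * c - (Pc_angle_sqr c t - 1 - c) ^+ 2 = (2 * a * sin t) ^+ 2.
  rewrite [RHS]exprMn sin2cos2 /Pc_angle_sqr.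
  by move: aa; set b := a => <-; ring.
rewrite sqrtr_sqr ger0_norm; last first.
  by rewrite !mulr_ge0 ?sqrtr_ge0// sin_ge0_pi// t0'.
rewrite /f /Pc_angle_density -(sqr_Pc_angle c_gt0).
have pn0 : (pi : R) != 0 by rewrite gt_eqF ?pi_gt0.
have xn0 : F t != 0 by rewrite gt_eqF.
move: (F t) xn0 => y yn0; move: aa; set b := a => <-.
by move: (@pi R) pn0 => p pn0; field; rewrite pn0 yn0.
Qed.

Let cg (x : R) : x \in `[`|1 - a|, 1 + a] -> {for x, continuous g}.
Proof.
rewrite in_itv/= /g => /andP[ax xa].
have cS (h : R -> R) : derivable h x 1 -> {for x, continuous (fun y => Num.sqrt (h y))}.
  move=> dh; apply: (@continuous_comp _ _ _ h Num.sqrt); last exact: sqrt_continuous.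
  by apply: differentiable_continuous; apply/derivable1_diffP.
case: (boolP (c == 1)) => c1.
  apply: (@continuousM R R (fun y : R => Num.sqrt (4 - y ^+ 2)) (fun=> (2 * pi)^-1)).
    by apply: (cS (fun y => 4 - y ^+ 2)); exact: ex_derive.
  exact: cvg_cst.
apply: (@continuousM R R (fun y : R => Num.sqrt (4 * c - (y ^+ 2 - 1 - c) ^+ 2))
  (fun y : R => (2 * pi * y)^-1)).
  by apply: (cS (fun y => 4 * c - (y ^+ 2 - 1 - c) ^+ 2)); exact: ex_derive.
apply: continuousV; last exact: mulrl_continuous.
rewrite mulf_neq0 ?mulf_neq0 ?gt_eqF ?pi_gt0//.
by rewrite (lt_le_trans _ ax)// normr_gt0 sqrt_neq1.
Qed.

(** Continuity of [G] is asked only for |x| <= 1 + sqrt c because the Cauchy kernel, to which this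
    is applied, may have a real pole farther out. *)
Lemma integral_Pc_density_pos (G : R -> R) :
  measurable_fun [set: measurableTypeR R] G ->
  (forall x, `|x| <= 1 + a -> {for x, continuous G}) ->
  (\int[mu]_(x in `]`|1 - a|%R, (1 + a)%R]) (G x * Pc_density c x)%:E =
   \int[mu]_(t in `[0%R, pi]) (G (F t) * rho t)%:E)%E.
Proof.
move=> mG cG.
transitivity (\int[mu]_(x in `[F pi, F 0%R]) (G x * g x)%:E)%E.
  rewrite Pc_anglepi// Pc_angle0// -integral_itv_obnd_cbnd; last first.
    apply/measurable_EFinP; apply: (@eq_measurable_fun _ _ _ _ _
      (fun x : measurableTypeR R => G x * Pc_density c x)).
      by move=> x; rewrite inE/= in_itv/= => xa; rewrite gE.
    apply: measurable_funM; apply: measurable_funTS => //.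
    exact: measurable_Pc_density.
  by apply: eq_integral => x; rewrite inE/= in_itv/= => xa; rewrite gE.
rewrite (@integration_by_substitution_decreasing _ F (fun x => G x * g x))//.
- have mGr : measurable_fun `]0, pi[ (fun t : measurableTypeR R => G (F t) * rho t).
    apply: measurable_funTS; apply: measurable_funM.
      by apply: (measurableT_comp mG); exact: measurable_Pc_angle.
    exact: measurable_Pc_angle_density.
  have E : {in `]0, pi[, (((fun x => G x * g x) \o F) * - (derive1 F)) =1
      (fun t => G (F t) * rho t)}.
    move=> t t0; rewrite /GRing.mul /GRing.opp/= dFE// -mulrA.
    by rewrite mulrN gF// opprK.
  apply: eq_integral_itv_bounded => //.
  apply: eq_measurable_fun mGr => t; rewrite inE/= => t0.
  by rewrite E.
- exact: pi_ge0.
- apply: continuous_in_subspaceT => x; rewrite inE/= Pc_anglepi// Pc_angle0// => xa.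
  apply: continuousM; last exact: cg.
  apply: cG; move: xa; rewrite in_itv/= => /andP[ax xa].
  by rewrite ger0_norm// (le_trans _ ax).
Qed.

End Pc_substitution_integral.

(** * Reflection of integrals against a symmetric measure *)

Section integral_opp.
Context {R : realType}.
Variable m : {measure set (measurableTypeR R) -> \bar R}.
Hypothesis mN : symmetric_measure m.
Local Open Scope ereal_scope.

Let mopp : measurable_fun [set: measurableTypeR R] (-%R : _ -> measurableTypeR R).
Proof. exact: measurable_funN. Qed.

Lemma ge0_integral_oppr (D : set (measurableTypeR R))
    (f : measurableTypeR R -> \bar R) :
  measurable D -> measurable_fun D f -> (forall x, D x -> 0 <= f x) ->
  \int[m]_(x in -%R @^-1` D) f (- x)%R = \int[m]_(x in D) f x.
Proof.
move=> mD mf f0.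
have := @ge0_integral_pushforward _ _ _ _ R _ mopp m D f mD mf.
rewrite /comp => <-; last by move=> y; rewrite inE; exact: f0.
by apply: eq_measure_integral => A mA _; rewrite -mN.
Qed.

Lemma integral_oppr (D : set (measurableTypeR R))
    (f : measurableTypeR R -> \bar R) :
  measurable D -> measurable_fun D f ->
  \int[m]_(x in -%R @^-1` D) f (- x)%R = \int[m]_(x in D) f x.
Proof.
move=> mD mf; rewrite integralE [RHS]integralE.
rewrite -(ge0_integral_oppr mD (measurable_funepos mf))//.
rewrite -(ge0_integral_oppr mD (measurable_funeneg mf))//.
congr (_ - _); apply: eq_integral => x _.
  by rewrite !funeposE.
by rewrite !funenegE.
Qed.

End integral_opp.

Section Pc_integral.
Variables (R : realType) (c : R).
Hypothesis c_gt0 : 0 < c.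
Local Notation mu := (@lebesgue_measure R).
Local Notation a := (Num.sqrt c).
Local Notation F := (Pc_angle c).
Local Notation rho := (Pc_angle_density c).

Lemma lebesgue_measure_symmetric : symmetric_measure mu.
Proof. by move=> A mA; exact: lebesgue_measureN. Qed.

Lemma integral_Pc_density (G : R -> R) :
  measurable_fun [set: measurableTypeR R] G ->
  (forall x, `|x| <= 1 + a -> {for x, continuous G}) ->
  (\int[mu]_x (G x * Pc_density c x)%:E =
   \int[mu]_(t in `[0%R, pi]) (G (F t) * rho t)%:E +
   \int[mu]_(t in `[0%R, pi]) (G (- F t) * rho t)%:E)%E.
Proof.
move=> mG cG.
pose U : set (measurableTypeR R) := [set` `]`|1 - a|, 1 + a]].
pose V : set (measurableTypeR R) := -%R @^-1` U.
have mU : measurable U by exact: measurable_itv.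
have mV : measurable V.
  rewrite /V -[X in measurable X]setTI; apply: measurable_funN => //.
have mh : measurable_fun [set: measurableTypeR R]
    (fun x => (G x * Pc_density c x)%:E).
  by apply/measurable_EFinP; apply: measurable_funM => //; exact: measurable_Pc_density.
transitivity (\int[mu]_(x in U `|` V) (G x * Pc_density c x)%:E)%E.
  rewrite [RHS]integral_mkcond; apply: eq_integral => x _; rewrite patchE.
  case: ifPn => //; rewrite notin_setE => nUV.
  have [->|/Pc_density_supp] := eqVneq (Pc_density c x) 0; first by rewrite mulr0.
  move=> /(_ c_gt0) xa; exfalso; apply: nUV.
  have [x0|x0] := leP 0 x.
    by left; rewrite /U/= in_itv/= -{1 2}(ger0_norm x0).
  by right; rewrite /V/U/= in_itv/= -(ltr0_norm x0).
rewrite integral_setU//; last 2 first.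
- exact: measurable_funTS.
- apply/disj_setPS => x []; rewrite /V /U/= !in_itv/= => /andP[x1 _] /andP[x2 _].
  have := le_lt_trans (normr_ge0 _) x1; have := le_lt_trans (normr_ge0 _) x2.
  by rewrite oppr_gt0 => /lt_trans h /h; rewrite ltxx.
congr (_ + _)%E; first exact: integral_Pc_density_pos.
rewrite -(integral_Pc_density_pos c_gt0 (G := G \o -%R)); last 2 first.
- by apply: measurableT_comp mG _; exact: measurable_funN.
- move=> x xa; apply: continuous_comp; first exact: opp_continuous.
  by apply: cG; rewrite normrN.
rewrite -(integral_oppr lebesgue_measure_symmetric mU).
  by apply: eq_integral => x _; rewrite /= opprK Pc_densityN.
apply/measurable_EFinP; apply: measurable_funTS.
apply: measurable_funM; last exact: measurable_Pc_density.
by apply: measurableT_comp mG _; exact: measurable_funN.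
Qed.

End Pc_integral.

(** * Total mass *)

Section Pc_mass.
Variables (R : realType) (c : R).
Hypothesis c_gt0 : 0 < c.
Local Notation mu := (@lebesgue_measure R).
Local Notation a := (Num.sqrt c).
Local Notation F := (Pc_angle c).
Local Notation rho := (Pc_angle_density c).

Let a_gt0 : 0 < a. Proof. by rewrite sqrtr_gt0. Qed.
Let aa : a ^+ 2 = c. Proof. by rewrite sqr_sqrtr// ltW. Qed.
Let pi_neq0 : (pi : R) != 0. Proof. by rewrite gt_eqF ?pi_gt0. Qed.

Let mu_fin : (mu `[0%R, pi] < +oo)%E.
Proof. by rewrite lebesgue_itv0pi ltry. Qed.

Lemma integral_sinX2_div_poisson_denom_real (r : R) : `|r| < 1 ->
  \int[mu]_(t in `[0, pi]) (sin t ^+ 2 / (1 - r * (2 * cos t) + r ^+ 2)) = pi / 2.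
Proof.
move=> r1; apply: complexI; rewrite -Cintegral_real.
have q1 : normc r%:C < 1 by rewrite normc_real.
rewrite -(Cintegral_sinX2_div_poisson_denom q1); apply: eq_Cintegral => t _.
rewrite /poisson_denom -!rmorphXn -rmorphM -[1 in RHS](rmorph1 (real_complex R)).
by rewrite -rmorphB -rmorphD -fmorphV -rmorphM.
Qed.

Lemma integrable_Pc_angle_density (G : R -> R) (M : R) :
  measurable_fun [set: measurableTypeR R] G ->
  (forall t, t \in `[0, pi] -> `|G t| <= M) ->
  mu.-integrable `[0, pi] (EFin \o (fun t => G t * rho t)).
Proof.
move=> mG GM; apply: (@integrable_bounded _ _ _ _ _ _ _ _ (M * pi^-1)) => //.
  apply: measurable_funTS; apply: measurable_funM => //.
  exact: measurable_Pc_angle_density.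
move=> t t0; rewrite normrM ler_pM// ?GM//.
by rewrite ger0_norm ?Pc_angle_density_ge0// Pc_angle_density_le.
Qed.

(** The Poisson kernel formula needs |q| < 1. For c < 1, X is the denominator with q = - sqrt c; for
    c > 1, X is c times the denominator with q = - 1 / sqrt c. For c = 1 the fraction reduces to (1
    - cos t) / (2 pi). The final factor 1/2 is there because [rho] represents only one sign of x. *)
Lemma integral_Pc_angle_density :
  \int[mu]_(t in `[0, pi]) rho t = Num.min 1 c / 2.
Proof.
have mS : measurable_fun [set: measurableTypeR R] (fun t : measurableTypeR R => sin t ^+ 2).
  apply: measurable_funX; apply: continuous_measurable_fun.
  exact: continuous_sin.
have iP (r : R) : `|r| < 1 -> mu.-integrable `[0, pi]
    (EFin \o (fun t : measurableTypeR R => sin t ^+ 2 / (1 - r * (2 * cos t) + r ^+ 2))).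
  move=> r1; have r1' : 0 < 1 - `|r| by rewrite subr_gt0.
  have H t : (1 - `|r|) ^+ 2 <= 1 - r * (2 * cos t) + r ^+ 2.
    have h : `|r * cos t| <= `|r| by rewrite normrM ler_piMr// cos_max.
    have := le_trans (ler_norm _) h.
    by rewrite sqrrB expr1n mul1r real_normK ?num_real// mulrCA; lra.
  apply: (@integrable_bounded _ _ _ _ _ _ _ _ (1 * ((1 - `|r|) ^+ 2)^-1)) => //.
    apply: measurable_funTS; apply: measurable_funM => //.
    apply: measurable_funV; apply: continuous_measurable_fun => t.
    by apply: differentiable_continuous; apply/derivable1_diffP.
  move=> t _; have Ht := lt_le_trans (exprn_gt0 2 r1') (H t).
  rewrite normrM ler_pM//.
    by rewrite normrX exprn_ile1// sin_max.
  by rewrite gtr0_norm ?invr_gt0// lef_pV2// posrE// exprn_gt0.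
have [c1|c1|c1] := ltgtP c 1.
- have a1 : `|- a| < 1.
    by rewrite normrN gtr0_norm// -(@ltr_pXn2r _ 2%N) ?nnegrE ?ler01 ?ltW// aa expr1n.
  rewrite (@eq_Rintegral _ _ _ _ _
    (fun t : measurableTypeR R => (c / pi) *
      (sin t ^+ 2 / (1 - (- a) * (2 * cos t) + (- a) ^+ 2)))).
    rewrite RintegralZl//; last exact: iP.
    by rewrite integral_sinX2_div_poisson_denom_real//; move: (@pi R) pi_neq0 => p pn0; field.
  move=> t _; rewrite /Pc_angle_density sqrrN aa.
  have -> : 1 - - a * (2 * cos t) + c = Pc_angle_sqr c t.
    by rewrite /Pc_angle_sqr; ring.
  by rewrite invfM; ring.
- have a1 : `|- a^-1| < 1.
    rewrite normrN gtr0_norm ?invr_gt0// invf_lt1//.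
    by rewrite -(@ltr_pXn2r _ 2%N) ?nnegrE ?ler01 ?(ltW a_gt0)// aa expr1n.
  rewrite (@eq_Rintegral _ _ _ _ _
    (fun t : measurableTypeR R => pi^-1 *
      (sin t ^+ 2 / (1 - (- a^-1) * (2 * cos t) + (- a^-1) ^+ 2)))).
    rewrite RintegralZl//; last exact: iP.
    by rewrite integral_sinX2_div_poisson_denom_real//; move: (@pi R) pi_neq0 => p pn0; field.
  move=> t _; rewrite /Pc_angle_density.
  have -> : 1 - - a^-1 * (2 * cos t) + (- a^-1) ^+ 2 = c^-1 * Pc_angle_sqr c t.
    rewrite /Pc_angle_sqr; move: aa a_gt0; set b := a => <- b0.
    by field; rewrite gt_eqF.
  have c0 : c != 0 by rewrite gt_eqF.
  by rewrite !invfM invrK; ring.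
(* The integrands agree only inside the interval: at pi the denominator is 0, so [rho] is 0 by
   convention while the other side is 1 / pi. *)
- have E : (\int[mu]_(t in `[0%R, pi]) (rho t)%:E =
      \int[mu]_(t in `[0%R, pi]) ((cos (0%:R * t) - cos (1%:R * t)) / (2 * pi))%:E)%E.
    apply: eq_integral_itv_bounded.
    + by apply: measurable_funTS; exact: measurable_Pc_angle_density.
    + apply: measurable_funTS; apply: continuous_measurable_fun => t.
      by apply: differentiable_continuous; apply/derivable1_diffP.
    + move=> t t0; rewrite mul0r mul1r cos0 /Pc_angle_density /Pc_angle_sqr c1 sqrtr1.
      have := cos_gtN1 t0; rewrite sin2cos2 => ct.
      have ct' : 2 + 2 * cos t != 0.
        by rewrite gt_eqF//; lra.
      by move: (@pi R) pi_neq0 => p pn0; field; rewrite pn0.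
  rewrite /Rintegral E -/(Rintegral _ _ _).
  have ic n : mu.-integrable `[0, pi] (EFin \o (fun t : measurableTypeR R => cos (n%:R * t))).
    apply: (@integrable_bounded _ _ _ _ _ _ _ _ 1) => //.
      apply: measurable_funTS; apply: continuous_measurable_fun => t.
      by apply: differentiable_continuous; apply/derivable1_diffP.
    by move=> t _; exact: cos_max.
  rewrite RintegralZr//; last first.
    rewrite (_ : _ \o _ = (EFin \o (fun t : measurableTypeR R => cos (0%:R * t))) \-
      (EFin \o (fun t : measurableTypeR R => cos (1%:R * t))))%E.
      exact: integrableB.
    by apply/funext => t; rewrite /= EFinB.
  rewrite RintegralB//; [|exact: ic..]; rewrite !integral_cosn/= subr0 ?c1.
  by move: (@pi R) pi_neq0 => p pn0; field; rewrite pn0.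
Qed.

Lemma integral_Pc_density1 :
  (\int[mu]_x (Pc_density c x)%:E = (Num.min 1 c)%:E)%E.
Proof.
have E : (\int[mu]_(t in `[0%R, pi]) (1 * rho t)%:E = (Num.min 1 c / 2)%:E)%E.
  rewrite -integral_Pc_angle_density /Rintegral fineK.
    by apply: eq_integral => t _; rewrite mul1r.
  apply: integrable_fin_num => //.
  rewrite (_ : (fun _ => _) = EFin \o (fun t => 1 * rho t)).
    apply: (@integrable_Pc_angle_density _ 1) => // t _.
    by rewrite normr1.
  by apply/funext => t; rewrite /= mul1r.
transitivity (\int[mu]_x (1 * Pc_density c x)%:E)%E.
  by apply: eq_integral => x _; rewrite mul1r.
rewrite (@integral_Pc_density _ _ c_gt0 (fun=> 1))//; last first.
  by move=> x _; exact: cvg_cst.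
by rewrite E -EFinD; congr EFin; field.
Qed.

End Pc_mass.

(** * The explicit law as a probability *)

Definition has_Pc_law (R : realType) (c : R) (P : probR R) :=
  forall A : set (measurableTypeR R), measurable A -> P A = Pc_measure c A.

Section Pc_probability.
Variables (R : realType) (c : R).
Hypothesis c_gt0 : 0 < c.
Local Notation mu := (@lebesgue_measure R).
Local Notation a := (Num.sqrt c).
Local Notation F := (Pc_angle c).
Local Notation rho := (Pc_angle_density c).
Local Notation atom := (Num.max (1 - c) 0).

Let mu_fin : (mu `[0%R, pi] < +oo)%E.
Proof. by rewrite lebesgue_itv0pi ltry. Qed.

Let atom_ge0 : 0 <= atom. Proof. by rewrite le_max lexx orbT. Qed.

Let ac := density_measure mu (Pc_density_ge0 c) (measurable_Pc_density c).

Let Pcm := measure_add (mscale (NngNum atom_ge0) (\d_(0 : measurableTypeR R))) ac.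

Let PcmD (A : set (measurableTypeR R)) : Pcm A =
  (atom%:E * \d_(0%R : measurableTypeR R) A +
   \int[mu]_(x in A) (Pc_density c x)%:E)%E.
Proof. by rewrite /Pcm measure_addE. Qed.

Let PcmE (A : set (measurableTypeR R)) : Pcm A = Pc_measure c A.
Proof.
rewrite PcmD /Pc_measure.
case: ifPn => [c1|]; last by rewrite -ltNge => c1; rewrite max_l// subr_ge0 ltW.
by rewrite max_r ?subr_le0// mul0e add0e.
Qed.

Let PcmT : Pcm setT = 1%E.
Proof.
rewrite PcmD integral_Pc_density1// diracT mule1 -EFinD; congr EFin.
by case: (leP 1 c) => c1; [rewrite max_r|rewrite max_l]; lra.
Qed.

Lemma exists_Pc : exists P : probR R, has_Pc_law c P.
Proof.
pose m : {measure set (measurableTypeR R) -> \bar R} := Pcm.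
pose P : probR R := HB.pack (Measure.sort m)
  (@Measure_isProbability.Build _ _ R (Measure.sort m) PcmT).
by exists P => A mA; exact: PcmE.
Qed.

Variable P : probR R.
Hypothesis isPc : has_Pc_law c P.

Lemma Pc_symmetric : symmetric_measure P.
Proof.
move=> A mA; have mNA : measurable (-%R @^-1` A : set (measurableTypeR R)).
  by rewrite -[X in measurable X]setTI; apply: measurable_funN.
rewrite -[LHS]/(P (-%R @^-1` A)) -[RHS]/(P A) !isPc// /Pc_measure.
have -> : (\int[mu]_(x in -%R @^-1` A) (Pc_density c x)%:E =
           \int[mu]_(x in A) (Pc_density c x)%:E)%E.
  rewrite -(ge0_integral_oppr (@lebesgue_measure_symmetric R) mA).
  - by apply: eq_integral => x _; rewrite Pc_densityN.
  - by apply/measurable_EFinP; apply: measurable_funTS; exact: measurable_Pc_density.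
  - by move=> x _; rewrite lee_fin Pc_density_ge0.
rewrite !diracE (_ : (0 \in -%R @^-1` A) = (0 \in A))//.
by apply/idP/idP; rewrite !inE/= oppr0.
Qed.

Lemma Rintegral_Pc (G : R -> R) (M : R) :
  measurable_fun [set: measurableTypeR R] G ->
  (forall x, `|x| <= 1 + a -> {for x, continuous G}) ->
  (forall x, `|x| <= 1 + a -> `|G x| <= M) ->
  \int[P]_x G x = atom * G 0 +
    \int[mu]_(t in `[0, pi]) ((G (F t) + G (- F t)) * rho t).
Proof.
move=> mG cG GM.
have Fle t : `|F t| <= 1 + a by rewrite ger0_norm ?Pc_angle_ge0// Pc_angle_le.
have mF : measurable_fun [set: measurableTypeR R] F by exact: measurable_Pc_angle.
have mGF (H : R -> R) : measurable_fun [set: measurableTypeR R] H ->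
    measurable_fun [set: measurableTypeR R] (fun t : measurableTypeR R => H (F t)) /\
    measurable_fun [set: measurableTypeR R] (fun t : measurableTypeR R => H (- F t)).
  move=> mH; split; first exact: (measurableT_comp mH).
  by apply: (measurableT_comp mH); exact: measurable_funN.
have iGF : mu.-integrable `[0, pi] (EFin \o (fun t : measurableTypeR R => G (F t) * rho t)).
  by apply: (@integrable_Pc_angle_density _ _ c_gt0 _ M) => [|t _];
    [exact: (mGF _ mG).1|exact: GM].
have iGNF : mu.-integrable `[0, pi] (EFin \o (fun t : measurableTypeR R => G (- F t) * rho t)).
  by apply: (@integrable_Pc_angle_density _ _ c_gt0 _ M) => [|t _];
    [exact: (mGF _ mG).2|rewrite GM// normrN].
have mnG : measurable_fun [set: measurableTypeR R] (fun x => `|G x|).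
  exact: measurableT_comp mG.
have E : (\int[ac]_x (G x)%:E = (\int[mu]_(t in `[0, pi])
    ((G (F t) + G (- F t)) * rho t))%:E)%E.
  rewrite integral_density// integral_Pc_density//.
  under eq_Rintegral do rewrite mulrDl.
  by rewrite RintegralD// EFinD /Rintegral !fineK//; exact: integrable_fin_num.
have iac : ac.-integrable setT (EFin \o G).
  apply/integrableP; split; first exact/measurable_EFinP.
  under eq_integral do rewrite /=.
  rewrite integral_density// integral_Pc_density//; last first.
    move=> x xa; apply: continuous_comp; first exact: cG.
    exact: norm_continuous.
  have GM' x : `|x| <= 1 + a -> `| `|G x| | <= M by rewrite normr_id; exact: GM.
  apply: lte_add_pinfty; apply: integrable_lty => //.
  - by apply: (@integrable_Pc_angle_density _ _ c_gt0 _ M) => [|t _];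
      [exact: (mGF _ mnG).1|exact: GM'].
  - by apply: (@integrable_Pc_angle_density _ _ c_gt0 _ M) => [|t _];
      [exact: (mGF _ mnG).2|apply: GM'; rewrite normrN].
transitivity (fine (\int[Pcm]_x (G x)%:E)%E).
  congr fine; apply: eq_measure_integral => A mA _.
  by rewrite -[LHS]/(P A) isPc// -PcmE.
have mEG : measurable_fun [set: measurableTypeR R] (EFin \o G) by exact/measurable_EFinP.
have idirac := integrable_dirac (0 : measurableTypeR R) mG.
rewrite /Pcm integral_measure_add//; last exact: integrable_mscale.
rewrite E integral_mscale//.
by rewrite integral_dirac// diracT mul1e -EFinM -EFinD.
Qed.

End Pc_probability.

(** * The transform H of the explicit law *)

Section Pc_Htransform.
Variables (R : realType) (c : R) (P : probR R).
Hypotheses (c_gt0 : 0 < c) (isPc : has_Pc_law c P).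
Local Notation mu := (@lebesgue_measure R).
Local Notation a := (Num.sqrt c).
Local Notation F := (Pc_angle c).
Local Notation X := (Pc_angle_sqr c).
Local Notation rho := (Pc_angle_density c).
Local Notation atom := (Num.max (1 - c) 0).
Local Notation B s := (poisson_denom (a%:C * s)).

Let a_gt0 : 0 < a. Proof. by rewrite sqrtr_gt0. Qed.
Let aa : a ^+ 2 = c. Proof. by rewrite sqr_sqrtr// ltW. Qed.
Let pi_neq0 : (pi : R) != 0. Proof. by rewrite gt_eqF ?pi_gt0. Qed.

Let mu_fin : (mu `[0%R, pi] < +oo)%E.
Proof. by rewrite lebesgue_itv0pi ltry. Qed.

Lemma cintegral_Pc (f : R -> R[i]) (M : R) :
  @Cmeasurable _ (measurableTypeR R) _ setT f ->
  (forall x, `|x| <= 1 + a -> {for x, continuous (fun t => complex.Re (f t))} /\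
     {for x, continuous (fun t => complex.Im (f t))}) ->
  (forall x, `|x| <= 1 + a -> normc (f x) <= M) ->
  cintegral P f = atom%:C * f 0 +
    Cintegral mu `[0, pi] (fun t => (f (F t) + f (- F t)) * (rho t)%:C).
Proof.
move=> [mRe mIm] cf fM; apply/eqP; rewrite eq_complex; apply/andP; split; apply/eqP.
- rewrite /cintegral [LHS]/= (Rintegral_Pc c_gt0 isPc (M := M))//; last 2 first.
  + by move=> x xa; exact: (cf x xa).1.
  + by move=> x xa; rewrite (le_trans (ler_norm_Re _))// fM.
  rewrite raddfD; congr (_ + _).
    by case: (f 0) => u v /=; rewrite mul0r subr0.
  rewrite [RHS]/=; apply: eq_Rintegral => t _.
  by case: (f (F t)) => u v; case: (f (- F t)) => u' v' /=; rewrite mulr0 subr0.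
- rewrite /cintegral [LHS]/= (Rintegral_Pc c_gt0 isPc (M := M))//; last 2 first.
  + by move=> x xa; exact: (cf x xa).2.
  + by move=> x xa; rewrite (le_trans (ler_norm_Im _))// fM.
  rewrite raddfD; congr (_ + _).
    by case: (f 0) => u v /=; rewrite mul0r addr0.
  rewrite [RHS]/=; apply: eq_Rintegral => t _.
  by case: (f (F t)) => u v; case: (f (- F t)) => u' v' /=; rewrite mulr0 add0r.
Qed.

(** This also holds where X = 0, since 0 <= c sin^2 t <= X forces both sides to vanish; the default
    value of the division does no harm. *)
Lemma Pc_angle_densityE t : pi * X t * rho t = c * sin t ^+ 2.
Proof.
have [X0|X0] := eqVneq (X t) 0; last first.
  rewrite /Pc_angle_density mulrC divfK// mulf_neq0//.
have : 0 <= c * sin t ^+ 2 <= X t.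
  rewrite mulr_ge0 ?sqr_ge0 ?(ltW c_gt0)//= -subr_ge0 sin2cos2.
  rewrite (_ : _ - _ = (1 + a * cos t) ^+ 2) ?sqr_ge0//.
  by rewrite /Pc_angle_sqr; move: aa; set b := a => <-; ring.
by rewrite X0 mulr0 mul0r -eq_le => /eqP.
Qed.

Lemma Pc_denomE (s : R[i]) t :
  B s t = (1 + s) * (1 + c%:C * s) - s * (X t)%:C.
Proof.
have aaC : a%:C * a%:C = c%:C :> R[i] by rewrite -rmorphM -expr2 aa.
rewrite /poisson_denom /Pc_angle_sqr !rmorphD !rmorphM rmorph1 /= -aaC.
by ring.
Qed.

Section at_point.
Variable s : R[i].
Hypothesis as1 : normc (a%:C * s) < 1.
Let D := (1 + s) * (1 + c%:C * s).
Hypothesis D0 : D != 0.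

Let BE t : B s t = D - s * (X t)%:C := Pc_denomE s t.

Let mB := @Cmeasurable_poisson_denom R (a%:C * s).

Let Cmeasurable_rho : @Cmeasurable _ (measurableTypeR R) _ `[0, pi] (fun t => (rho t)%:C).
Proof.
apply: Cmeasurable_real; apply: measurable_funTS.
exact: measurable_Pc_angle_density.
Qed.

Let Cbounded_rho : @Cbounded _ (measurableTypeR R) _ `[0, pi] (fun t => (rho t)%:C).
Proof.
exists (pi^-1) => t _; rewrite normc_real ger0_norm ?Pc_angle_density_ge0//.
exact: Pc_angle_density_le.
Qed.

(** As D = B + s X and X rho = (c / pi) sin^2 t, one has rho / B = rho / D + (s c / pi) sin^2 t / (D
    B). The first term integrates to half the continuous mass, the second is the Poisson kernel
    integral with q = s sqrt c. *)
Lemma Cintegral_Pc_angle_density_div :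
  Cintegral mu `[0, pi] (fun t => (rho t)%:C / B s t) =
  (Num.min 1 c)%:C / 2 / D + c%:C * s / 2 / D.
Proof.
have mS : @Cmeasurable _ (measurableTypeR R) _ `[0, pi]
    (fun t => (sin t ^+ 2)%:C / B s t).
  apply: CmeasurableM; last by apply: CmeasurableV; exact: mB.
  apply: Cmeasurable_real; apply: measurable_funTS; apply: measurable_funX.
  by apply: continuous_measurable_fun; exact: continuous_sin.
have bS : @Cbounded _ (measurableTypeR R) _ `[0, pi]
    (fun t => (sin t ^+ 2)%:C / B s t).
  exists (1 * ((1 - normc (a%:C * s)) ^+ 2)^-1) => t _.
  rewrite [leLHS]normcM ler_pM ?normc_ge0//; last exact: normc_poisson_denomV_le.
  by rewrite normc_real normrX exprn_ile1// sin_max.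
pose k : R[i] := s * (c / pi)%:C.
transitivity (Cintegral mu `[0, pi] (fun t : measurableTypeR R =>
    D^-1 * (rho t)%:C + (D^-1 * k) * ((sin t ^+ 2)%:C / B s t))).
  apply: eq_Cintegral => t _.
  have B0 := poisson_denom_neq0 as1 t.
  apply: (mulfI D0); rewrite mulrDr !mulrA mulfV// !mul1r.
  apply: (mulIf B0); rewrite mulfVK// mulrDl mulfVK//.
  have -> : k * (sin t ^+ 2)%:C = s * (X t)%:C * (rho t)%:C.
    rewrite /k -!mulrA -!rmorphM; congr (_ * _%:C).
    rewrite mulrAC -Pc_angle_densityE; move: (@pi R) pi_neq0 => p pn0; field.
    exact: pn0.
  by rewrite BE; ring.
rewrite CintegralD//; last 4 first.
- by apply: CmeasurableM => //; exact: Cmeasurable_cst.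
- have [M hM] := Cbounded_rho; exists (normc D^-1 * M) => t t0.
  by rewrite normcM ler_wpM2l ?normc_ge0// hM.
- by apply: CmeasurableM => //; exact: Cmeasurable_cst.
- have [M hM] := bS; exists (normc (D^-1 * k) * M) => t t0.
  by rewrite normcM ler_wpM2l ?normc_ge0// hM.
rewrite !CintegralZl// Cintegral_real integral_Pc_angle_density//.
rewrite Cintegral_sinX2_div_poisson_denom//.
rewrite -[D^-1 * k * _]mulrA.
have -> : k * (pi / 2)%:C = c%:C * s / 2.
  rewrite /k -mulrA -rmorphM (_ : c / pi * (pi / 2) = c / 2).
    by rewrite rmorphM fmorphV rmorph_nat; ring.
  by move: (@pi R) pi_neq0 => p pn0; field.
by rewrite rmorphM fmorphV rmorph_nat; ring.
Qed.

End at_point.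

End Pc_Htransform.

Section Htransform_Pc.
Variables (R : realType) (c : R) (P : probR R).
Hypotheses (c_gt0 : 0 < c) (isPc : has_Pc_law c P).
Local Notation mu := (@lebesgue_measure R).
Local Notation a := (Num.sqrt c).
Local Notation F := (Pc_angle c).
Local Notation X := (Pc_angle_sqr c).
Local Notation rho := (Pc_angle_density c).
Local Notation atom := (Num.max (1 - c) 0).

Let a_gt0 : 0 < a. Proof. by rewrite sqrtr_gt0. Qed.

Let mu_fin : (mu `[0%R, pi] < +oo)%E.
Proof. by rewrite lebesgue_itv0pi ltry. Qed.

Lemma continuous_cauchy_kernel (k : R[i]) (x : R) : k != x%:C ->
  {for x, continuous (fun t : R => complex.Re (k - t%:C)^-1)} /\
  {for x, continuous (fun t : R => complex.Im (k - t%:C)^-1)}.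
Proof.
case: k => u v; rewrite -subr_eq0 => kx.
have den0 : (u - x) ^+ 2 + v ^+ 2 != 0.
  apply: contra kx; rewrite eq_complex/= subr0.
  by rewrite paddr_eq0 ?sqr_ge0// !sqrf_eq0.
have cV : {for x, continuous (fun t : R => ((u - t) ^+ 2 + v ^+ 2)^-1)}.
  apply: continuousV => //.
  by apply: differentiable_continuous; apply/derivable1_diffP.
split.
- rewrite (_ : (fun _ => _) = (fun t : R => (u - t) * ((u - t) ^+ 2 + v ^+ 2)^-1)).
    apply: continuousM => //.
    by apply: differentiable_continuous; apply/derivable1_diffP.
  by apply/funext => t /=; rewrite subr0.
- rewrite (_ : (fun _ => _) = (fun t : R => (- v) * ((u - t) ^+ 2 + v ^+ 2)^-1)).
    apply: continuousM => //; exact: cvg_cst.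
  by apply/funext => t /=; rewrite subr0 mulNr.
Qed.

(** The last hypothesis puts the pole k = 1 / sqrt h at modulus at least 2 (1 + sqrt c), hence at
    distance at least 1 from the support. Adding the kernel at F and at - F gives 2 k / (k^2 - F^2),
    which is 2 k s / B because k^2 = D / s. *)
Lemma Htransform_Pc (s h : R[i]) :
  s != 0 -> normc (a%:C * s) < 1 -> 1 + s != 0 -> 1 + c%:C * s != 0 ->
  h = s / ((1 + s) * (1 + c%:C * s)) ->
  normc h * (2 * (1 + a)) ^+ 2 <= 1 ->
  Htransform P h = s / (1 + s).
Proof.
move=> s0 as1 s1 cs1; set D := (1 + s) * _ => hE hsmall.
have D0 : D != 0 by rewrite mulf_neq0.
have h0 : h != 0 by rewrite hE mulf_neq0// invr_eq0.
have sh0 : sqrtC h != 0 by rewrite sqrtC_eq0.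
have t2_gt0 : 0 < 1 + a by rewrite addr_gt0.
pose k := (sqrtC h)^-1.
have k0 : k != 0 by rewrite invr_eq0.
have kk : k ^+ 2 = h^-1 by rewrite exprVn sqrtCK.
have nk : 2 * (1 + a) <= normc k.
  rewrite -ler_sqr ?nnegrE ?normc_ge0 ?mulr_ge0 ?(ltW t2_gt0)//.
  rewrite -normcX kk normcV -[leRHS]mul1r ler_pdivlMr ?normc_gt0//.
  by rewrite mulrC.
have nkt (t : R) : `|t| <= 1 + a -> 1 <= normc (k - t%:C).
  move=> ta; rewrite (le_trans _ (normcB_ge _ _))// normc_real.
  rewrite lerBrDr (le_trans _ nk)// mulr_natl mulr2n lerD// lerDl.
  exact: ltW.
have Fle t : `|F t| <= 1 + a by rewrite ger0_norm ?Pc_angle_ge0// Pc_angle_le.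
have kt0 (t : R) : `|t| <= 1 + a -> k - t%:C != 0.
  by move=> /nkt ta; rewrite -normc_gt0 (lt_le_trans _ ta).
rewrite /Htransform /cauchy_transform -/k.
rewrite (@cintegral_Pc _ c P c_gt0 isPc _ 1); first last.
- move=> t ta; rewrite normcV invf_le1; first exact: nkt.
  by rewrite (lt_le_trans _ (nkt _ ta)).
- by move=> t ta; apply: continuous_cauchy_kernel; rewrite -subr_eq0 kt0.
- apply: CmeasurableV; apply: CmeasurableB; first exact: Cmeasurable_cst.
  by apply: Cmeasurable_real; exact: measurable_id.
rewrite (@eq_Cintegral _ _ _ _ _ _ (fun t : measurableTypeR R =>
    (2 * k * s) * ((rho t)%:C / poisson_denom (a%:C * s) t))); last first.
  move=> t _; have B0 := poisson_denom_neq0 as1 t.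
  have BE : poisson_denom (a%:C * s) t = D - s * (X t)%:C.
    exact: Pc_denomE.
  have k1 : k - (F t)%:C != 0 by rewrite kt0.
  have k2 : k - (- F t)%:C != 0 by rewrite kt0// normrN.
  have kB : (k - (F t)%:C) * (k - (- F t)%:C) * s = poisson_denom (a%:C * s) t.
    rewrite BE -sqr_Pc_angle// rmorphXn rmorphN/= opprK mulrC -subr_sqr kk hE.
    by rewrite invf_div mulrBr mulrCA mulfV// mulr1.
  rewrite -kB rmorphN/= opprK in k2 *.
  by field; rewrite s0 k1 k2.
rewrite CintegralZl//; last 2 first.
- apply: CmeasurableM; last by apply: CmeasurableV; exact: Cmeasurable_poisson_denom.
  apply: Cmeasurable_real; apply: measurable_funTS.
  exact: measurable_Pc_angle_density.
- exists (pi^-1 * ((1 - normc (a%:C * s)) ^+ 2)^-1) => t _.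
  rewrite [leLHS]normcM ler_pM ?normc_ge0//; last exact: normc_poisson_denomV_le.
  by rewrite normc_real ger0_norm ?Pc_angle_density_ge0// Pc_angle_density_le.
rewrite Cintegral_Pc_angle_density_div// -/D.
(* In this form the atom contributes h atom from the point 0 and - (s / D) atom from the continuous
   mass; these cancel since h = s / D. *)
have -> : (Num.min 1 c)%:C = 1 - atom%:C :> R[i].
  rewrite -(rmorph1 (real_complex R)) -rmorphB; congr (_%:C).
  by case: (leP 1 c) => c1; [rewrite max_r|rewrite max_l]; lra.
rewrite rmorph0 subr0 mulrDr [_ * (_ * k^-1)]mulrCA.
have -> : sqrtC h / k = h by rewrite /k invrK -expr2 sqrtCK.
have -> : sqrtC h * (2 * k * s * ((1 - atom%:C) / 2 / D + c%:C * s / 2 / D)) =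
   (sqrtC h * k) * (s * (1 - atom%:C + c%:C * s) / D).
  by field.
rewrite /k mulfV// mul1r hE /D; field.
by rewrite s1 cs1.
Qed.

End Htransform_Pc.

(** * Its rectangular R-transform and infinite divisibility *)

Lemma sector_germ_ball (R : realType) (b : R) (Q : R[i] -> Prop) : 0 < b ->
  (forall z, 0 < normc z < b -> Q z) -> sector_germ Q.
Proof. by move=> b0 bQ alpha _; exists b => // z [_ zb]; exact: bQ. Qed.

(* The smaller of the two roots has modulus at most [sqrt (normc w)]. *)
Lemma exists_small_root (R : realType) (b w : R[i]) :
  exists2 z, z ^+ 2 - b * z + w = 0 & normc z ^+ 2 <= normc w.
Proof.
pose d := sqrtC (b ^+ 2 - 4 * w).
have dd : d ^+ 2 = b ^+ 2 - 4 * w by rewrite sqrtCK.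
pose z1 := (b + d) / 2; pose z2 := (b - d) / 2.
have z12 : z1 * z2 = w.
  have -> : z1 * z2 = (b ^+ 2 - d ^+ 2) / 4 by rewrite /z1 /z2; field.
  by rewrite dd; field.
have nz : normc z1 * normc z2 = normc w by rewrite -normcM z12.
have e1 : z1 ^+ 2 - b * z1 + w = 0.
  have -> : z1 ^+ 2 - b * z1 + w = (d ^+ 2 - b ^+ 2) / 4 + w.
    by rewrite /z1; field.
  by rewrite dd; field.
have e2 : z2 ^+ 2 - b * z2 + w = 0.
  have -> : z2 ^+ 2 - b * z2 + w = (d ^+ 2 - b ^+ 2) / 4 + w.
    by rewrite /z2; field.
  by rewrite dd; field.
have [z1z2|z2z1] := leP (normc z1) (normc z2).
- by exists z1 => //; rewrite expr2 -nz ler_wpM2l ?normc_ge0.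
- by exists z2 => //; rewrite expr2 -nz ler_wpM2r ?normc_ge0// ltW.
Qed.

Section Pc_Rtransform.
Variables (R : realType) (c : R) (P : probR R).
Hypotheses (c_gt0 : 0 < c) (isPc : has_Pc_law c P).
Local Notation a := (Num.sqrt c).

(** Solution of z / h - 1 = c z / (1 - z), the R-transform to be realised. *)
Definition Pc_Hinv (z : R[i]) : R[i] := z * (1 - z) / (1 - z + c%:C * z).
Local Notation h := Pc_Hinv.

Let L : R := 1 + a.
Let a_gt0 : 0 < a. Proof. by rewrite sqrtr_gt0. Qed.
Let aa : a ^+ 2 = c. Proof. by rewrite sqr_sqrtr// ltW. Qed.
Let L_ge1 : 1 <= L. Proof. by rewrite lerDl ltW. Qed.
Let c_le : c <= L ^+ 2.
Proof.
rewrite -subr_ge0 (_ : _ - _ = 1 + 2 * a); last first.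
  by rewrite /L; move: aa; set b := a => <-; ring.
by rewrite addr_ge0// mulr_ge0// ltW.
Qed.
Let L2_ge1 : 1 <= L ^+ 2. Proof. by rewrite exprn_ege1. Qed.

(** Below this radius both |z| and L^2 |z|, hence c |z|, are less than 1/16. So 1 - z and 1 - z + c
    z stay away from 0, and h z meets the smallness condition of [Htransform_Pc]. *)
Definition Pc_radius := (16 * L ^+ 2)^-1.
Local Notation r0 := Pc_radius.

Let r0_gt0 : 0 < r0.
Proof. by rewrite invr_gt0 mulr_gt0// (lt_le_trans _ L2_ge1). Qed.

Let small (z : R[i]) : normc z < r0 -> normc z * L ^+ 2 < 16^-1 /\ normc z < 16^-1.
Proof.
rewrite /r0 invfM => zr.
have L2_gt0 : 0 < L ^+ 2 by rewrite (lt_le_trans _ L2_ge1).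
rewrite -ltr_pdivlMr//; split => //.
by rewrite (lt_le_trans zr)// ler_piMr// invf_le1.
Qed.

Let n1 : normc (1 : R[i]) = 1.
Proof. by rewrite -[1]/((1 : R)%:C) normc_real normr1. Qed.

Let normc_1Bz (z : R[i]) : normc z < r0 -> 15 / 16 <= normc (1 - z) <= 17 / 16.
Proof.
move=> /small[_ z1]; apply/andP; split.
  by rewrite (le_trans _ (normcB_ge _ _))// n1; lra.
by rewrite (le_trans (le_normcD _ _))// normcN n1; lra.
Qed.

Let normc_den (z : R[i]) : normc z < r0 -> 14 / 16 <= normc (1 - z + c%:C * z).
Proof.
move=> zr; have [zL z1] := small zr.
rewrite -[c%:C * z]opprK (le_trans _ (normcB_ge _ _))// normcN normcM normc_real.
rewrite gtr0_norm//; have /andP[+ _] := normc_1Bz zr.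
have : c * normc z <= normc z * L ^+ 2 by rewrite mulrC ler_wpM2l// normc_ge0.
lra.
Qed.

Let z1_neq0 z : normc z < r0 -> 1 - z != 0.
Proof. by move=> /normc_1Bz/andP[z1 _]; rewrite -normc_gt0; lra. Qed.

Let den_neq0 z : normc z < r0 -> 1 - z + c%:C * z != 0.
Proof. by move=> /normc_den z1; rewrite -normc_gt0; lra. Qed.

Lemma Htransform_Pc_Hinv z : 0 < normc z < r0 -> Htransform P (h z) = z.
Proof.
move=> /andP[z_gt0 zr]; have [zL z1] := small zr.
have z0 : z != 0 by rewrite -normc_gt0.
have z10 := z1_neq0 zr; have zd0 := den_neq0 zr.
have /andP[nz1 nz1'] := normc_1Bz zr; have nd := normc_den zr.
pose s := z / (1 - z).
have s1E : 1 + s = (1 - z)^-1 by rewrite /s; field.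
have cs1E : 1 + c%:C * s = (1 - z + c%:C * z) / (1 - z) by rewrite /s; field.
have ns : normc s <= normc z * (16 / 15).
  rewrite /s normcM normcV ler_wpM2l ?normc_ge0//.
  rewrite -[leRHS]invrK lef_pV2 ?posrE ?invr_gt0//; last by lra.
  by rewrite invf_div.
rewrite (Htransform_Pc c_gt0 isPc (s := s)).
- by rewrite s1E /s invrK mulfVK.
- by rewrite mulf_neq0// invr_eq0.
- rewrite normcM normc_real gtr0_norm//.
  have : a * normc s <= L ^+ 2 * (normc z * (16 / 15)).
    rewrite ler_pM ?normc_ge0 ?(ltW a_gt0)// (@le_trans _ _ L)//.
      by rewrite lerDr.
    by rewrite expr2 ler_peMr// (le_trans _ L_ge1).
  by lra.
- by rewrite s1E invr_eq0.
- by rewrite cs1E mulf_neq0// invr_eq0.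
- by rewrite s1E cs1E /h /s; field; rewrite z10 zd0.
- rewrite /h normcM normcM normcV exprMn.
  have L0 : 0 <= L ^+ 2 by rewrite sqr_ge0.
  have d0 : 0 < normc (1 - z + c%:C * z) by rewrite normc_gt0.
  rewrite mulrAC ler_pdivrMr// mul1r (le_trans _ nd)//.
  have : normc z * normc (1 - z) * (2 ^+ 2 * L ^+ 2) <= (normc z * L ^+ 2) * (17 / 16 * 4).
    have -> : normc z * normc (1 - z) * (2 ^+ 2 * L ^+ 2) =
      (normc z * L ^+ 2) * (normc (1 - z) * 4) by ring.
    apply: ler_wpM2l; first by rewrite mulr_ge0 ?normc_ge0.
    by lra.
  by rewrite -/L; lra.
Qed.

(** Clearing denominators in h z = w gives z^2 - (1 + w - c w) z + w = 0. Its smaller root satisfies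
    |z|^2 <= |w|, which explains the squared radius, and then H w = H (h z) = z. *)
Lemma Pc_Hinv_Htransform w : 0 < normc w < r0 ^+ 2 -> h (Htransform P w) = w.
Proof.
move=> /andP[w_gt0 wr]; have w0 : w != 0 by rewrite -normc_gt0.
have [z zE zw] := exists_small_root (1 + w - c%:C * w) w.
have zr : normc z < r0.
  by rewrite -ltr_sqr ?nnegrE ?normc_ge0 ?(ltW r0_gt0)// (le_lt_trans zw).
have z0 : z != 0.
  by apply: contra w0 => /eqP z0; rewrite -zE z0 expr0n mulr0 subr0 add0r.
have hz : h z = w.
  apply: (mulIf (den_neq0 zr)); rewrite /h mulfVK ?den_neq0//.
  by apply/eqP; rewrite -subr_eq0 -oppr_eq0 -[X in _ == X]zE; apply/eqP; ring.
by rewrite -{1}hz Htransform_Pc_Hinv// normc_gt0 z0.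
Qed.

Lemma Htransform_inverse_Pc : Htransform_inverse P h.
Proof.
split.
- apply: (sector_germ_ball r0_gt0) => z /andP[_ zr].
  apply: (@derivableM R[i] R[i]^o (fun z : R[i]^o => z * (1 - z) : R[i]^o)
    (fun z : R[i]^o => (1 - z + c%:C * z)^-1 : R[i]^o)) => //.
  by apply: derivableV => //; exact: den_neq0.
- move=> eps eps0.
  have L2_gt0 : 0 < 2 * L ^+ 2 by rewrite mulr_gt0// (lt_le_trans _ L2_ge1).
  have b0 : 0 < Num.min r0 (eps / (2 * L ^+ 2)) by rewrite lt_min r0_gt0 divr_gt0.
  apply: (sector_germ_ball b0) => z /andP[z_gt0].
  rewrite lt_min => /andP[zr].
  rewrite ltr_pdivlMr// => ze.
  have z0 : z != 0 by rewrite -normc_gt0.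
  have zd0 := den_neq0 zr; have nd := normc_den zr.
  have -> : h z / z - 1 = - (c%:C * z / (1 - z + c%:C * z)).
    by rewrite /h; field; rewrite z0 zd0.
  rewrite normcN normcM normcV ltr_pdivrMr ?normc_gt0//.
  rewrite normcM normc_real gtr0_norm//.
  have h1 : c * normc z <= normc z * L ^+ 2 by rewrite mulrC ler_wpM2l// normc_ge0.
  have h2 : eps * (14 / 16) <= eps * normc (1 - z + c%:C * z) by rewrite ler_pM2l.
  by lra.
- by apply: (sector_germ_ball r0_gt0) => z; exact: Htransform_Pc_Hinv.
- apply: (sector_germ_ball (exprn_gt0 2 r0_gt0)) => w.
  exact: Pc_Hinv_Htransform.
Qed.

(** Any representative of the germ is allowed, so that the lemma applies both to the sum of two such
    germs and to the integral against the Levy measure. *)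
Lemma rect_Rtransform_Pc (f : R[i] -> R[i]) :
  sector_germ (fun z => f z = c%:C * z / (1 - z)) -> rect_Rtransform P f.
Proof.
move=> fE; split; first exact: Pc_symmetric isPc.
exists h; first exact: Htransform_inverse_Pc.
move=> alpha al; have [b b0 bf] := fE alpha al.
have m0 : 0 < Num.min b r0 by rewrite lt_min b0 r0_gt0.
exists (Num.min b r0) => // z [za /andP[z_gt0]]; rewrite lt_min => /andP[zb zr].
rewrite bf; last by split => //; rewrite z_gt0 zb.
have z0 : z != 0 by rewrite -normc_gt0.
by rewrite /h; field; rewrite z0 z1_neq0// den_neq0.
Qed.

End Pc_Rtransform.

Section Pc_infdiv.
Variable R : realType.

Lemma boxplus0_Pc (c1 c2 : R) (P1 P2 P3 : probR R) : 0 < c1 -> 0 < c2 ->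
  has_Pc_law c1 P1 -> has_Pc_law c2 P2 -> has_Pc_law (c1 + c2) P3 ->
  boxplus0 P1 P2 P3.
Proof.
move=> c1_gt0 c2_gt0 h1 h2 h3.
exists (fun z => c1%:C * z / (1 - z)), (fun z => c2%:C * z / (1 - z)); split.
- by apply: (rect_Rtransform_Pc c1_gt0 h1); exact: (sector_germ_ball ltr01).
- by apply: (rect_Rtransform_Pc c2_gt0 h2); exact: (sector_germ_ball ltr01).
- apply: (rect_Rtransform_Pc (addr_gt0 c1_gt0 c2_gt0) h3).
  by apply: (sector_germ_ball ltr01) => z _; rewrite rmorphD/= -mulrDl -mulrDl.
Qed.

Lemma boxplus0_power_Pc (c : R) (nu : probR R) n : 0 < c -> has_Pc_law c nu ->
  exists2 rho : probR R, has_Pc_law (c * n.+1%:R) rho & boxplus0_power nu n.+1 rho.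
Proof.
move=> c0 hnu; elim: n => [|n [rho hrho nurho]].
  by exists nu; [rewrite mulr1|exact: boxplus0_power1].
have c1 : 0 < c * n.+2%:R by rewrite mulr_gt0.
have [P hP] := exists_Pc c1; exists P => //.
apply: boxplus0_powerS nurho _.
have cn : 0 < c * n.+1%:R by rewrite mulr_gt0.
apply: (boxplus0_Pc cn c0 hrho hnu).
by move: hP; rewrite -natr1 mulrDr mulr1.
Qed.

Lemma boxplus0_infdiv_Pc (c : R) (P : probR R) : 0 < c -> has_Pc_law c P ->
  boxplus0_infdiv P.
Proof.
move=> c0 hP; split; first exact: Pc_symmetric hP.
case=> [//|[|n]] _.
  exists P; split; first exact: Pc_symmetric hP.
  exact: boxplus0_power1.
have cn0 : 0 < c / n.+2%:R by rewrite divr_gt0.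
have [nu hnu] := exists_Pc cn0.
exists nu; split; first exact: Pc_symmetric hnu.
(* [boxplus0_power_Pc] only yields some measure with the right law, while the power must end at [P]
   itself; hence the last convolution is done by hand. *)
have [rho hrho nurho] := boxplus0_power_Pc n cn0 hnu.
apply: boxplus0_powerS nurho _.
apply: (boxplus0_Pc _ cn0 hrho hnu); first by rewrite mulr_gt0.
rewrite (_ : _ + _ = c)// -[X in _ + X]mulr1 -mulrDr natr1 divfK//.
Qed.

End Pc_infdiv.

(** * Uniqueness of a symmetric law with given Stieltjes transform *)

Lemma bernoulli_ge1 (R : realDomainType) (x : R) n :
  0 <= x -> 1 + n%:R * x <= (1 + x) ^+ n.
Proof.
move=> x0; elim: n => [|n ih]; first by rewrite mul0r addr0.
rewrite exprSr (@le_trans _ _ ((1 + n%:R * x) * (1 + x)))//.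
  rewrite -natr1 -subr_ge0 (_ : _ - _ = n%:R * x ^+ 2); last by ring.
  by rewrite mulr_ge0// sqr_ge0.
by rewrite ler_wpM2r// addr_ge0.
Qed.

Lemma bernoulli_le1 (R : realDomainType) (x : R) n :
  0 <= x <= 1 -> 1 - n%:R * x <= (1 - x) ^+ n.
Proof.
move=> /andP[x0 x1]; elim: n => [|n ih]; first by rewrite mul0r subr0.
rewrite exprSr (@le_trans _ _ ((1 - n%:R * x) * (1 - x)))//.
  rewrite -natr1 -subr_ge0 (_ : _ - _ = n%:R * x ^+ 2); last by ring.
  by rewrite mulr_ge0// sqr_ge0.
by rewrite ler_wpM2r// subr_ge0.
Qed.

(** With r = s^2, Bernoulli's inequality bounds n s^n, and the other factor s^n tends to 0. *)
Lemma cvg_natM_geometric (R : realType) (r : R) : 0 < r < 1 ->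
  (n%:R * r ^+ n) @[n --> \oo] --> (0 : R).
Proof.
move=> /andP[r0 r1]; pose s := Num.sqrt r.
have s0 : 0 < s by rewrite sqrtr_gt0.
have s1 : s < 1 by rewrite -sqrtr1 ltr_sqrt.
pose x := s^-1 - 1.
have x0 : 0 < x by rewrite subr_gt0 invf_gt1.
have H n : n%:R * s ^+ n <= x^-1.
  rewrite -ler_pdivlMr ?exprn_gt0// ler_pdivlMl//.
  rewrite -exprVn (_ : s^-1 = 1 + x); last by rewrite /x addrC subrK.
  by rewrite (le_trans _ (bernoulli_ge1 n (ltW x0)))// mulrC lerDr.
have cs : (s ^+ n * x^-1) @[n --> \oo] --> (0 : R).
  rewrite -(mul0r x^-1); apply: cvgMl; apply: cvg_expr.
  by rewrite ger0_norm// ltW.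
apply: (squeeze_cvgr _ (cvg_cst 0) cs); apply: nearW => n.
rewrite mulr_ge0 ?exprn_ge0// ?(ltW r0)//=.
rewrite -(sqr_sqrtr (ltW r0)) -/s -exprM mulnC exprM expr2 mulrCA.
by rewrite mulrC mulrAC [leRHS]mulrC ler_wpM2r// ?exprn_ge0 ?(ltW s0)// H.
Qed.

(* A bounded sequence of polynomials converging pointwise on [[0, 1]] to the
   indicator of [[0, b[]. *)
Definition step_poly (R : realType) (b u : R) (n : nat) : R :=
  (1 - u ^+ n.+1) ^+ Num.trunc (n.+1%:R / b ^+ n.+1).

Lemma step_poly_itv01 (R : realType) (b u : R) n :
  0 <= u <= 1 -> 0 <= step_poly b u n <= 1.
Proof.
move=> /andP[u0 u1].
have un1 : 0 <= 1 - u ^+ n.+1 <= 1.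
  by rewrite subr_ge0 exprn_ile1//= lerBlDr lerDl exprn_ge0.
by move: un1 => /andP[? ?]; rewrite /step_poly exprn_ge0//= exprn_ile1.
Qed.

(** Put N = n + 1, x = u^N and let m be the exponent. If u < b, Bernoulli gives (1 - x)^m >= 1 - m x
    >= 1 - N (u / b)^N. If u >= b, then (1 - x)^m <= (1 + x)^(- m) <= 1 / (1 + m x) <= 1 / N; the
    factor N in the exponent makes this work at u = b too. *)
Lemma cvg_step_poly (R : realType) (b u : R) : 0 < b -> 0 < u <= 1 ->
  step_poly b u n @[n --> \oo] --> ((u < b)%R%:R : R).
Proof.
move=> b0 /andP[u0 u1].
have u01 : 0 <= u <= 1 by rewrite (ltW u0).
have pb n : 0 < b ^+ n by rewrite exprn_gt0.
have un n : 0 <= u ^+ n <= 1 by rewrite exprn_ge0 ?(ltW u0)//= exprn_ile1// ltW.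
have nb n : 0 <= n.+1%:R / b ^+ n.+1 by rewrite divr_ge0// ltW.
have [ub|bu] := ltP u b; rewrite /= ?mulr1n ?mulr0n.
- have r01 : 0 < u / b < 1 by rewrite divr_gt0//= ltr_pdivrMr// mul1r.
  have c1 : (1 - n.+1%:R * (u / b) ^+ n.+1) @[n --> \oo] --> (1 : R).
    rewrite -[X in _ --> X]subr0; apply: cvgB; first exact: cvg_cst.
    have := cvg_natM_geometric r01.
    by rewrite -(cvg_shiftS (fun n => n%:R * (u / b) ^+ n)).
  apply: (@squeeze_cvgr _ _ _ _ (fun n => 1 - n.+1%:R * (u / b) ^+ n.+1)
    (fun=> 1) _ _ _ c1 (cvg_cst (1 : R))); apply: nearW => n.
  have /andP[_ ->] := step_poly_itv01 b n u01; rewrite andbT.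
  rewrite (le_trans _ (bernoulli_le1 _ (un n.+1)))// lerD2l lerN2.
  rewrite expr_div_n [leRHS]mulrCA [leLHS]mulrC ler_pM2l ?exprn_gt0//.
  by rewrite truncn_le.
- have c0 : (n.+1%:R^-1) @[n --> \oo] --> (0 : R) by exact: cvg_harmonic.
  apply: (@squeeze_cvgr _ _ _ _ (fun=> 0) (fun n => n.+1%:R^-1) _ _ _
    (cvg_cst (0 : R)) c0); apply: nearW => n.
  have /andP[-> _] := step_poly_itv01 b n u01; rewrite andTb.
  rewrite /step_poly; set m := Num.trunc _.
  have /andP[x0 x1] := un n.+1.
  set x := u ^+ n.+1 in x0 x1 *.
  (* Truncating the exponent loses less than 1, and x <= 1, so the added 1 absorbs the loss. *)
  have mx : n.+1%:R <= 1 + m%:R * x.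
    have hm : n.+1%:R <= m.+1%:R * b ^+ n.+1.
      by rewrite -ler_pdivrMr// ltW// truncnS_gt.
    rewrite (le_trans hm)// (@le_trans _ _ (m.+1%:R * x))//.
      by rewrite ler_wpM2l// lerXn2r// ?nnegrE ?ltW.
    by rewrite -natr1 mulrDl mul1r addrC lerD2r.
  have h1 : n.+1%:R <= (1 + x) ^+ m by rewrite (le_trans mx)// bernoulli_ge1.
  rewrite -[leRHS]mul1r ler_pdivlMr//.
  rewrite (@le_trans _ _ ((1 - x) ^+ m * (1 + x) ^+ m))//.
    by rewrite ler_wpM2l// exprn_ge0// subr_ge0.
  rewrite -exprMn exprn_ile1//.
    by rewrite mulr_ge0// ?subr_ge0// addr_ge0.
  rewrite (_ : _ * _ = 1 - x ^+ 2); last by ring.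
  by rewrite lerBlDr lerDl sqr_ge0.
Qed.

Lemma probability_bounded_integrable d (T : measurableType d) (R : realType)
    (P : probability T R) (f : T -> R) (M : R) :
  measurable_fun setT f -> (forall x, `|f x| <= M) ->
  P.-integrable setT (EFin \o f).
Proof.
move=> mf fM; apply: (@integrable_bounded _ _ _ _ _ _ _ _ M) => //.
exact: (fin_num_fun_lty (fin_num_measure P)).
Qed.

Lemma Rintegral_cst_probability d (T : measurableType d) (R : realType)
    (P : probability T R) (r : R) : \int[P]_(t in setT) r = r.
Proof.
rewrite Rintegral_cst// (_ : fine _ = 1) ?mulr1//.
exact: (congr1 fine (probability_setT P)).
Qed.

(** * From Stieltjes transforms to moments of a bounded variable *)

Section equal_stieltjes_moments.
Variables (R : realType) (P Q : probR R) (Y0 : R).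
Hypothesis Y0_gt0 : 0 < Y0.
Hypothesis stieltjesPQ : forall Y, Y0 < Y ->
  \int[P]_t (Y + t ^+ 2)^-1 = \int[Q]_t (Y + t ^+ 2)^-1.

Let v (t : R) := (Y0 + t ^+ 2)^-1.

Let v_gt0 t : 0 < v t.
Proof. by rewrite invr_gt0 ltr_pwDl// sqr_ge0. Qed.

Let v_le t : v t <= Y0^-1.
Proof. by rewrite lef_pV2 ?posrE ?ltr_pwDl ?sqr_ge0// lerDl sqr_ge0. Qed.

Let mv : measurable_fun [set: measurableTypeR R] v.
Proof. by apply: measurable_funV; apply: measurable_funD. Qed.

(** For k = 1 this is 1 / (Y0 + d + t^2), the Stieltjes kernel shifted by d; for d = 0 it is the
    power v^k. *)
Let vd k (d t : R) := v t ^+ k / (1 + d * v t).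

Let den_ge1 d t : 0 <= d -> 1 <= 1 + d * v t.
Proof. by move=> d0; rewrite lerDl mulr_ge0// ltW. Qed.

Let vd_itv k d t : 0 <= d -> 0 <= vd k d t <= Y0^-1 ^+ k.
Proof.
move=> d0; have d1 := den_ge1 t d0.
have dgt0 : 0 < 1 + d * v t by rewrite (lt_le_trans _ d1).
have vk0 : 0 <= v t ^+ k by rewrite exprn_ge0// ltW.
rewrite /vd divr_ge0 ?(ltW dgt0)//= ler_pdivrMr//.
rewrite (@le_trans _ _ (Y0^-1 ^+ k))//.
  by rewrite lerXn2r ?nnegrE ?v_le// ?(ltW (v_gt0 _))// invr_ge0 ltW.
by rewrite ler_peMr// exprn_ge0// invr_ge0 ltW.
Qed.

Let mvd k d : measurable_fun [set: measurableTypeR R] (vd k d).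
Proof.
apply: measurable_funM; first exact: measurable_funX.
by apply: measurable_funV; apply: measurable_funD => //; exact: measurable_funM.
Qed.

Let ivd (m : probR R) k d : 0 <= d -> m.-integrable setT (EFin \o vd k d).
Proof.
move=> d0; apply: (@probability_bounded_integrable _ _ _ _ _ (Y0^-1 ^+ k)) => //.
by move=> t; have /andP[? ?] := vd_itv k t d0; rewrite ger0_norm.
Qed.

Let Rint_vd_rec (m : probR R) k d : 0 < d ->
  \int[m]_t vd k.+1 d t = (\int[m]_t vd k 0 t - \int[m]_t vd k d t) / d.
Proof.
move=> d0; have dn0 : d != 0 by rewrite gt_eqF.
apply: (mulfI dn0); rewrite mulrCA mulfV// mulr1.
rewrite -RintegralZl//; last exact: (ivd _ _ (ltW d0)).
rewrite -RintegralB//; [|exact: ivd|exact: (ivd _ _ (ltW d0))].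
apply: eq_Rintegral => t _.
have dgt0 : 1 + d * v t != 0.
  by rewrite gt_eqF// (lt_le_trans _ (den_ge1 t (ltW d0))).
by rewrite /vd mul0r addr0 exprS; field.
Qed.

Let Rint_vd_itv (m : probR R) k d : 0 <= d ->
  0 <= \int[m]_t vd k d t <= Y0^-1 ^+ k.
Proof.
move=> d0; rewrite Rintegral_ge0/=; last first.
  by move=> t _; have /andP[] := vd_itv k t d0.
rewrite (@le_trans _ _ (\int[m]_(t in setT) Y0^-1 ^+ k))//.
  apply: le_Rintegral => //; first exact: ivd.
    exact: (@probability_bounded_integrable _ _ _ _ _ (`|Y0^-1 ^+ k|)).
  by move=> t _; have /andP[] := vd_itv k t d0.
by rewrite Rintegral_cst_probability.
Qed.

(** Limit d -> 0 made explicit: v^k differs from [vd k d] by d times [vd k.+1 d], whose integral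
    lies in [0, C]. Hence the choice d = e / C. *)
Let Rint_vd0 k : (forall d, 0 < d -> \int[P]_t vd k d t = \int[Q]_t vd k d t) ->
  \int[P]_t vd k 0 t = \int[Q]_t vd k 0 t.
Proof.
move=> PQ; apply/eqP; rewrite -subr_eq0 -normr_le0; apply/ler_addgt0Pl => e e0.
rewrite addr0; pose C := Y0^-1 ^+ k.+1.
have C0 : 0 < C by rewrite exprn_gt0// invr_gt0.
pose d := e / C; have d0 : 0 < d by rewrite divr_gt0.
have dn0 : d != 0 by rewrite gt_eqF.
have E (m : probR R) : \int[m]_t vd k 0 t =
    \int[m]_t vd k d t + d * \int[m]_t vd k.+1 d t.
  by rewrite Rint_vd_rec// mulrCA mulfV// mulr1 addrC subrK.
rewrite !E PQ// opprD addrACA subrr add0r -mulrBr normrM gtr0_norm//.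
rewrite mulrC -ler_pdivlMr// /d invf_div mulrCA mulfV ?gt_eqF// mulr1.
have /andP[p0 p1] := Rint_vd_itv P k.+1 (ltW d0).
have /andP[q0 q1] := Rint_vd_itv Q k.+1 (ltW d0).
by rewrite ler_norml -/C in p1 q1 *; apply/andP; split; lra.
Qed.

(** Order 1 is the hypothesis at Y0 + d. If an order agrees for all d > 0, it agrees at d = 0 by
    [Rint_vd0], and the recurrence then gives the next order. *)
Let Rint_vd k d : 0 < d -> \int[P]_t vd k.+1 d t = \int[Q]_t vd k.+1 d t.
Proof.
elim: k d => [|k ih] d d0; last first.
  by rewrite (Rint_vd_rec P)// (Rint_vd_rec Q)// (ih d)// (Rint_vd0 ih).
have E (m : probR R) : \int[m]_t vd 1 d t = \int[m]_t (Y0 + d + t ^+ 2)^-1.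
  apply: eq_Rintegral => t _; rewrite /vd /v.
  have t1 : Y0 + t ^+ 2 != 0 by rewrite gt_eqF// ltr_pwDl// sqr_ge0.
  have t2 : Y0 + d + t ^+ 2 != 0.
    by rewrite gt_eqF// ltr_pwDl ?sqr_ge0// addr_gt0.
  by field; rewrite t1 t2.
by rewrite !E stieltjesPQ// ltrDl.
Qed.

Lemma stieltjes_moments k :
  \int[P]_t (Y0 / (Y0 + t ^+ 2)) ^+ k = \int[Q]_t (Y0 / (Y0 + t ^+ 2)) ^+ k.
Proof.
have E (m : probR R) : \int[m]_t (Y0 / (Y0 + t ^+ 2)) ^+ k =
    Y0 ^+ k * \int[m]_t vd k 0 t.
  rewrite -RintegralZl//; last exact: ivd.
  by apply: eq_Rintegral => t _; rewrite /vd mul0r addr0 divr1 exprMn.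
rewrite !E; congr (_ * _); case: k {E} => [|k].
  have E (m : probR R) : \int[m]_t vd 0 0 t = 1.
    rewrite (@eq_Rintegral _ _ _ _ _ (fun=> 1)).
      by rewrite Rintegral_cst_probability.
    by move=> t _; rewrite /vd mul0r addr0 divr1 expr0.
  by rewrite !E.
by apply: Rint_vd0 => d d0; exact: Rint_vd.
Qed.

End equal_stieltjes_moments.

(** * A symmetric law is determined by the law of its absolute value *)

Section symmetric_probability_unique.
Variables (R : realType) (P Q : probR R).

Let norm : measurableTypeR R -> measurableTypeR R := fun t => `|t|.

Let mnorm : measurable_fun setT norm.
Proof. exact: normr_measurable. Qed.

Let absm : {mfun measurableTypeR R >-> measurableTypeR R} :=
  HB.pack norm (isMeasurableFun.Build _ _ _ _ norm mnorm).

Let Pn : probR R := distribution P absm.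
Let Qn : probR R := distribution Q absm.

(** By symmetry 2 P(A) is the integral of the even function 1_A(t) + 1_A(-t), hence an integral
    against the law of |t|. That law is fixed by its values on rays. *)
Lemma symmetric_probability_unique :
  symmetric_measure P -> symmetric_measure Q ->
  (forall r, 0 <= r -> P [set t | r < `|t|] = Q [set t | r < `|t|]) ->
  forall A : set (measurableTypeR R), measurable A -> P A = Q A.
Proof.
move=> sP sQ PQ.
have PQn (B : set (measurableTypeR R)) : measurable B -> Pn B = Qn B.
  apply: (@measure_unique _ R (measurableTypeR R) (@RGenOInfty.G R)
    (fun k => `](- k%:R), +oo[%classic) _ _ _ _ Pn Qn).
  - exact: RGenOInfty.measurableE.
  - move=> _ _ [x ->] [y ->]; exists (Num.max x y).
    by apply/seteqP; split => z /=; rewrite !in_itv/= !andbT ?gt_max => /andP.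
  - by move=> k; exists (- k%:R).
  - apply/seteqP; split => // x _; exists (Num.trunc `|x|).+1 => //=.
    rewrite in_itv/= andbT ltrNl (le_lt_trans (ler_norm _))// normrN.
    exact: truncnS_gt.
  - move=> _ [x ->]; rewrite /Pn /Qn /= /distribution /pushforward/=.
    have -> : norm @^-1` `]x, +oo[ = [set t | x < `|t|].
      by apply/seteqP; split => t /=; rewrite in_itv/= andbT.
    have [x0|x0] := leP 0 x; first exact: PQ.
    (* Rays with a negative end point belong to the generating family, which is what lets countably
       many cover the line; the law of |t| gives them mass 1. *)
    have -> : [set t : measurableTypeR R | x < `|t|] = setT.
      by apply/seteqP; split => // t _ /=; rewrite (lt_le_trans x0).
    exact: etrans (probability_setT P) (esym (probability_setT Q)).
  - by move=> k; rewrite -ge0_fin_numE//; exact: (fin_num_measure Pn).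
move=> A mA.
pose phi (t : measurableTypeR R) : \bar R := (\1_A t + \1_A (- t))%:E.
have mN : measurable_fun [set: measurableTypeR R]
    (fun t : measurableTypeR R => - t : measurableTypeR R).
  exact: measurable_funN.
have m1 : measurable_fun [set: measurableTypeR R] (fun t : measurableTypeR R => (\1_A t : R)).
  exact: measurable_indic.
have m2 : measurable_fun [set: measurableTypeR R] (fun t : measurableTypeR R => (\1_A (- t) : R)).
  exact: (measurableT_comp m1 mN).
have mphi : measurable_fun [set: measurableTypeR R] phi.
  by apply/measurable_EFinP; exact: measurable_funD.
have phi0 t : (0 <= phi t)%E by rewrite lee_fin addr_ge0.
have phi_norm t : phi `|t| = phi t.
  by rewrite /phi; case: (ger0P t) => // _; rewrite opprK addrC.
have E (m : probR R) : symmetric_measure m ->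
    (m A + m A = \int[distribution m absm]_t phi t)%E.
  move=> sm; rewrite ge0_integral_distribution//.
  transitivity (\int[m]_t ((\1_A t)%:E + (\1_A (- t))%:E))%E.
    rewrite ge0_integralD//; [|exact/measurable_EFinP|exact/measurable_EFinP].
    have -> : (\int[m]_t (\1_A (- t))%:E)%E = (\int[m]_t (\1_A t)%:E)%E.
      rewrite -(@ge0_integral_oppr _ m sm setT (fun t => (\1_A t)%:E))//.
      exact/measurable_EFinP.
    by rewrite integral_indic// setIT.
  by apply: eq_integral => t _; rewrite /= phi_norm -EFinD.
have : (P A + P A = Q A + Q A)%E.
  by rewrite !E//; apply: eq_measure_integral => B mB _; exact: PQn.
have fP : (P A \is a fin_num)%E by exact: fin_num_measure.
have fQ : (Q A \is a fin_num)%E by exact: fin_num_measure.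
rewrite -(fineK fP) -(fineK fQ) -!EFinD => -[h]; congr EFin.
by lra.
Qed.

End symmetric_probability_unique.

Section stieltjes_unique.
Variables (R : realType) (P Q : probR R) (Y0 : R).
Hypothesis Y0_gt0 : 0 < Y0.
Hypothesis stieltjesPQ : forall Y, Y0 < Y ->
  \int[P]_t (Y + t ^+ 2)^-1 = \int[Q]_t (Y + t ^+ 2)^-1.

Let u (t : R) := Y0 / (Y0 + t ^+ 2).

Let u_itv t : 0 < u t <= 1.
Proof.
have h : 0 < Y0 + t ^+ 2 by rewrite ltr_pwDl// sqr_ge0.
by rewrite /u divr_gt0//= ler_pdivrMr// mul1r lerDl sqr_ge0.
Qed.

Let u01 t : 0 <= u t <= 1.
Proof. by have /andP[/ltW-> ->] := u_itv t. Qed.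

Let mu : measurable_fun [set: measurableTypeR R] u.
Proof.
by apply: measurable_funM => //; apply: measurable_funV; exact: measurable_funD.
Qed.

(** The factor u^j closes the induction on m: multiplying by one more 1 - u^n produces the terms
    with j and j + n. *)
Let f n j m t := u t ^+ j * (1 - u t ^+ n) ^+ m.

Let mf n j m : measurable_fun [set: measurableTypeR R] (f n j m).
Proof.
apply: measurable_funM; first exact: measurable_funX.
apply: measurable_funX; apply: measurable_funB => //; exact: measurable_funX.
Qed.

Let f_itv n j m t : `|f n j m t| <= 1.
Proof.
have /andP[u0 u1] := u01 t.
have un1 : 0 <= 1 - u t ^+ n <= 1.
  by rewrite subr_ge0 exprn_ile1//= lerBlDr lerDl exprn_ge0.
move: un1 => /andP[a0 a1].
by rewrite ger0_norm ?mulr_ge0 ?exprn_ge0// mulr_ile1 ?exprn_ge0// exprn_ile1.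
Qed.

Let Rint_f n j m : \int[P]_t f n j m t = \int[Q]_t f n j m t.
Proof.
elim: m j => [|m ih] j.
  have E (p : probR R) : \int[p]_t f n j 0 t = \int[p]_t (Y0 / (Y0 + t ^+ 2)) ^+ j.
    by apply: eq_Rintegral => t _; rewrite /f expr0 mulr1.
  by rewrite !E; exact: stieltjes_moments.
have E (p : probR R) :
    \int[p]_t f n j m.+1 t = \int[p]_t f n j m t - \int[p]_t f n (j + n) m t.
  rewrite -RintegralB//;
    try exact: (@probability_bounded_integrable _ _ _ _ _ 1).
  by apply: eq_Rintegral => t _; rewrite /f exprS exprD; ring.
by rewrite !E !ih.
Qed.

Let Rint_step b n :
  \int[P]_t step_poly b (u t) n = \int[Q]_t step_poly b (u t) n.
Proof.
have E (p : probR R) : \int[p]_t step_poly b (u t) n =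
    \int[p]_t f n.+1 0 (Num.trunc (n.+1%:R / b ^+ n.+1)) t.
  by apply: eq_Rintegral => t _; rewrite /f expr0 mul1r.
by rewrite !E Rint_f.
Qed.

Let mstep b n : measurable_fun [set: measurableTypeR R] (fun t => step_poly b (u t) n).
Proof. by apply: measurable_funX; apply: measurable_funB => //; exact: measurable_funX. Qed.

Let set_gt_norm (r : R) : 0 <= r ->
  [set t : measurableTypeR R | r < `|t|] = [set t | u t < u r].
Proof.
move=> r0; have pos t : 0 < Y0 + t ^+ 2 by rewrite ltr_pwDl// sqr_ge0.
apply/seteqP; split => t /=; rewrite /u.
  move=> rt; rewrite ltr_pM2l// ltf_pV2 ?posrE ?pos// ltrD2l.
  by rewrite -[ltRHS]real_normK ?num_real// ltr_sqr ?nnegrE.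
rewrite ltr_pM2l// ltf_pV2 ?posrE ?pos// ltrD2l.
by rewrite -[ltRHS]real_normK ?num_real// ltr_sqr ?nnegrE.
Qed.

Let measure_gt_norm (m : probR R) (r : R) : 0 <= r ->
  (\int[m]_t step_poly (u r) (u t) n)%:E @[n --> \oo] --> m [set t | r < `|t|].
Proof.
move=> r0; rewrite set_gt_norm//; set A := [set t | _].
have mA : measurable A.
  rewrite (_ : A = u @^-1` `]-oo, u r[).
    by rewrite -[X in measurable X]setTI; exact: mu.
  by apply/seteqP; split => t; rewrite /A/= in_itv.
have -> : m A = (\int[m]_t (\1_A t)%:E)%E by rewrite integral_indic// setIT.
have -> : (fun n => (\int[m]_t step_poly (u r) (u t) n)%:E) =
    (fun n => (\int[m]_t (step_poly (u r) (u t) n)%:E)%E).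
  apply/funext => n; rewrite /Rintegral fineK//; apply: integrable_fin_num => //.
  apply: (@probability_bounded_integrable _ _ _ _ _ 1) => // t.
  by have /andP[? ?] := step_poly_itv01 (u r) n (u01 t); rewrite ger0_norm.
apply: (@dominated_cvg _ _ _ m setT measurableT _ _ (fun=> 1%E)) => //.
- by move=> n; exact/measurable_EFinP.
- move=> t _; apply: cvg_EFin; first exact: nearW.
  have /andP[ur0 _] := u_itv r.
  have := @cvg_step_poly _ (u r) (u t) ur0 (u_itv t).
  rewrite indicE (_ : (t \in A) = (u t < u r))//.
  by apply/idP/idP; rewrite inE.
- apply: (@probability_bounded_integrable _ _ _ _ (fun=> 1) 1) => // t.
  by rewrite normr1.
- move=> n t _; rewrite lee_fin.
  by have /andP[? ?] := step_poly_itv01 (u r) n (u01 t); rewrite ger0_norm.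
Qed.

Lemma symmetric_stieltjes_unique :
  symmetric_measure P -> symmetric_measure Q ->
  forall A : set (measurableTypeR R), measurable A -> P A = Q A.
Proof.
move=> sP sQ; apply: symmetric_probability_unique => // r r0.
have cP := @measure_gt_norm P r r0; have cQ := @measure_gt_norm Q r r0.
have E : (fun n => (\int[P]_t step_poly (u r) (u t) n)%:E) =
         (fun n => (\int[Q]_t step_poly (u r) (u t) n)%:E).
  by apply/funext => n; rewrite Rint_step.
by rewrite E in cP; exact: (cvg_unique _ cP cQ).
Qed.

End stieltjes_unique.

(** * Uniqueness of the Levy measure *)

Lemma cvg_expRM_bounded (R : realType) (b K : R) (g : R -> R) : 0 < b ->
  (forall x, 0 <= x -> `|g x| <= K) ->
  expR (- b * x) * g x @[x --> +oo%R] --> (0 : R).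
Proof.
move=> b0 gK; have K0 : 0 <= K by rewrite (le_trans _ (gK 0 (lexx _))).
have ce : expR (- b * x) @[x --> +oo%R] --> (0 : R).
  rewrite (_ : (fun x => expR (- b * x)) =
               (fun z => expR (- z)) \o (fun z => b * z)); last first.
    by apply: eq_fun => x; rewrite mulNr.
  apply: (@cvg_comp _ _ _ _ _ _ (pinfty_nbhs R)); last exact: cvgr_expR.
  exact: gt0_cvgMry.
have cK : expR (- b * x) * K @[x --> +oo%R] --> (0 : R).
  by rewrite -[X in _ --> X](mul0r K); exact: cvgMl.
have cNK : - (expR (- b * x) * K) @[x --> +oo%R] --> (0 : R).
  by rewrite -oppr0; exact: cvgN.
apply: (@squeeze_cvgr _ _ _ _ (fun x => - (expR (- b * x) * K))
  (fun x => expR (- b * x) * K) _ _ _ cNK cK).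
near=> x; rewrite -ler_norml normrM ger0_norm ?expR_ge0//.
by rewrite ler_wpM2l ?expR_ge0// gK.
Unshelve. all: by end_near. Qed.

Section laplace_levy_kernel.
Variables (R : realType) (b : R).
Hypothesis b_gt0 : 0 < b.
Local Notation mu := (@lebesgue_measure R).

Let b_neq0 : b != 0. Proof. by rewrite gt_eqF. Qed.

Lemma levy_kernel_le0 (xi t : R) : levy_kernel xi t <= 0.
Proof.
rewrite /levy_kernel; case: ifPn => [_|t0].
  by rewrite oppr_le0 divr_ge0// sqr_ge0.
rewrite mulr_le0_ge0 ?subr_le0 ?cos_le1//.
by rewrite divr_ge0 ?addr_ge0 ?sqr_ge0.
Qed.

Lemma FTC2y_is_derive (F f : R -> R) (l : R) :
  (forall x, 0 <= x -> 0 <= f x) ->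
  (forall x : R, is_derive x 1 F (f x)) -> continuous f ->
  F x @[x --> +oo%R] --> l ->
  (\int[mu]_(x in `[0%R, +oo[) (f x)%:E = (l - F 0)%:E)%E.
Proof.
move=> f0 dF cf Fl; have cF := is_derive_continuous dF.
rewrite (@ge0_continuous_FTC2y _ f F 0 l) ?EFinB//.
- exact: continuous_subspaceT.
- exact/cvg_at_right_filter/cF.
- by move=> x _; rewrite derive1E; have [_ ->] := dF x.
Qed.

Lemma laplace_levy_kernel0 :
  (\int[mu]_(x in `[0%R, +oo[) (expR (- b * x) * - levy_kernel x 0)%:E =
   (b ^- 3)%:E)%E.
Proof.
under eq_integral do rewrite /levy_kernel eqxx opprK.
pose F x := - (expR (- b * x) * (x ^+ 2 / (2 * b) + x / b ^+ 2 + b ^- 3)).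
have dF (x : R) : is_derive x 1 F (expR (- b * x) * (x ^+ 2 / 2)).
  apply: is_derive_eq; rewrite /GRing.scale/=; field.
  exact: b_neq0.
rewrite (@FTC2y_is_derive F _ 0 _ dF).
- by rewrite /F mulr0 expR0; congr EFin; field.
- by move=> x _; rewrite mulr_ge0 ?expR_ge0// divr_ge0// sqr_ge0.
- by move=> x; apply: differentiable_continuous; apply/derivable1_diffP.
(* Half of the exponential decay is spent on bounding the polynomial factor; the other half gives
   the limit 0. *)
pose g x := expR (- (b / 2) * x) * (x ^+ 2 / (2 * b) + x / b ^+ 2 + b ^- 3).
have FE x : F x = - (expR (- (b / 2) * x) * g x).
  by rewrite /F /g mulrA -expRD; congr (- (expR _ * _)); field.
suff cg : expR (- (b / 2) * x) * g x @[x --> +oo%R] --> (0 : R).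
  have cN : - (expR (- (b / 2) * x) * g x) @[x --> +oo%R] --> (0 : R).
    by rewrite -oppr0; exact: cvgN.
  by rewrite (eq_cvg _ _ FE).
apply: (@cvg_expRM_bounded _ _ (13 * b ^- 3)); first by rewrite divr_gt0.
(* With this y, e^(- b x / 2) is e^(- 2 y) and the polynomial is (8 y^2 + 4 y + 1) / b^3. Since y
   and 1 are at most e^y, the constant is 8 + 4 + 1 = 13. *)
move=> x x0; pose y := b * x / 4.
have y0 : 0 <= y by rewrite divr_ge0// mulr_ge0// ltW.
have ye : y <= expR y by rewrite (le_trans _ (expR_ge1Dx y))// lerDr.
have e1 : 1 <= expR y by rewrite -expR0 ler_expR.
have -> : g x = (8 * y ^+ 2 + 4 * y + 1) * b ^- 3 / expR y ^+ 2.
  rewrite /g (_ : - (b / 2) * x = - y + - y); last by rewrite /y; field.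
  rewrite expRD expRN /y; have := expR_gt0 (b * x / 4); move: (expR _) => E E0.
  by field; rewrite b_neq0 gt_eqF.
have b3 : 0 < b ^- 3 by rewrite invr_gt0 exprn_gt0.
have E2 : 0 < expR y ^+ 2 by rewrite exprn_gt0// expR_gt0.
rewrite ger0_norm; last first.
  by apply: divr_ge0; [apply: mulr_ge0; [nra|exact: ltW]|exact: ltW].
rewrite ler_pdivrMr// mulrAC ler_wpM2r ?(ltW b3)//.
by move: (expR y) ye e1 => E ye e1; nra.
Qed.

(** The Laplace transform of 1 - cos (t x) at b is t^2 / (b (b^2 + t^2)), and the weight of the
    kernel removes t^2. The formula remains right at t = 0 because the kernel is extended there by
    continuity. *)
Lemma laplace_levy_kernel (t : R) :
  (\int[mu]_(x in `[0%R, +oo[) (expR (- b * x) * - levy_kernel x t)%:E =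
   ((1 + t ^+ 2) / (b * (b ^+ 2 + t ^+ 2)))%:E)%E.
Proof.
have [->|t0] := eqVneq t 0.
  rewrite laplace_levy_kernel0; congr EFin; rewrite expr0n/= !addr0.
  by field.
have bt0 : b ^+ 2 + t ^+ 2 != 0 by rewrite gt_eqF// ltr_pwDl ?exprn_gt0 ?sqr_ge0.
under eq_integral do rewrite /levy_kernel (negbTE t0).
pose C := (1 + t ^+ 2) / t ^+ 2.
pose g x := C * (- b^-1 - (t * sin (t * x) - b * cos (t * x)) / (b ^+ 2 + t ^+ 2)).
have dF (x : R) : is_derive x 1 (fun x => expR (- b * x) * g x)
    (expR (- b * x) * - ((cos (t * x) - 1) * C)).
  apply: is_derive_eq; rewrite /GRing.scale/= /g; move: (C) => k; field.
  by rewrite bt0 b_neq0.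
rewrite (@FTC2y_is_derive (fun x => expR (- b * x) * g x) _ 0 _ dF).
- rewrite /g !mulr0 expR0 sin0 cos0 /C; congr EFin; field.
  by rewrite bt0 t0 b_neq0.
- move=> x _; rewrite mulr_ge0 ?expR_ge0// -mulNr mulr_ge0 ?opprB ?subr_ge0 ?cos_le1//.
  by rewrite divr_ge0 ?addr_ge0 ?sqr_ge0.
- by move=> x; apply: differentiable_continuous; apply/derivable1_diffP.
apply: (@cvg_expRM_bounded _ _ (`|C| * (b^-1 + (`|t| + b) / (b ^+ 2 + t ^+ 2)))) => //.
move=> x _; rewrite /g normrM ler_wpM2l//.
rewrite (le_trans (ler_normB _ _))// normrN ger0_norm ?invr_ge0 ?(ltW b_gt0)//.
rewrite lerD2l normrM normfV [X in _ / X]ger0_norm ?addr_ge0 ?sqr_ge0//.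
rewrite ler_wpM2r ?invr_ge0 ?addr_ge0 ?sqr_ge0//.
rewrite (le_trans (ler_normB _ _))// !normrM (gtr0_norm b_gt0) lerD//.
  by rewrite ler_piMr// sin_max.
by rewrite ler_piMr ?cos_max// ltW.
Qed.

End laplace_levy_kernel.

Lemma sin_le_id (R : realType) (x : R) : 0 <= x -> sin x <= x.
Proof.
move=> x0; have [y _] := @MVT_segment _ sin cos 0 x x0
  (fun z _ => is_derive_sin z) (continuous_subspaceT (@continuous_sin R)).
by rewrite sin0 !subr0 => ->; rewrite ler_piMl// cos_le1.
Qed.

Lemma onem_cos_le (R : realType) (x : R) : 1 - cos x <= x ^+ 2.
Proof.
rewrite -(cos_norm x) -(real_normK (num_real x)).
move: `|x| (normr_ge0 x) => {}x x0.
have [y yx] := @MVT_segment _ cos (fun z => - sin z) 0 x x0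
  (fun z _ => is_derive_cos z) (continuous_subspaceT (@continuous_cos R)).
have /andP[y0 {}yx] : 0 <= y <= x by move: yx; rewrite in_itv.
rewrite cos0 subr0 => h; rewrite -opprB h mulNr opprK expr2 ler_wpM2r//.
by rewrite (le_trans (sin_le_id y0)).
Qed.

(** Writing the weight as 1 / t^2 + 1, the first part is bounded through 1 - cos y <= y^2 and the
    second by 2. Being uniform in t, the bound gives integrability against any finite measure. *)
Lemma levy_kernel_bound (R : realType) (xi t : R) :
  `|levy_kernel xi t| <= xi ^+ 2 + 2.
Proof.
rewrite ler0_norm ?levy_kernel_le0// /levy_kernel.
have xi0 := sqr_ge0 xi.
case: ifPn => [_|t0]; first by rewrite opprK; lra.
have t2 : 0 < t ^+ 2 by rewrite exprn_even_gt0.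
rewrite -mulNr opprB [(1 + _) / _]mulrDl mul1r divff ?gt_eqF// mulrDr mulr1 lerD//.
  by rewrite ler_pdivrMr// mulrC -exprMn mulrC onem_cos_le.
by have := cos_geN1 (t * xi); lra.
Qed.

Section levy_measure_unique.
Variable R : realType.
Local Notation mu := (@lebesgue_measure R).

Lemma measurable_levy_kernel_pair :
  measurable_fun [set: measurableTypeR R * measurableTypeR R]
    (fun p => levy_kernel p.1 p.2).
Proof.
have m1 := @measurable_fst _ _ (measurableTypeR R) (measurableTypeR R).
have m2 := @measurable_snd _ _ (measurableTypeR R) (measurableTypeR R).
rewrite /levy_kernel; apply: measurable_fun_ifT.
- by apply: measurable_fun_eqr.
- by apply: measurable_funN; apply: measurable_funM => //; exact: measurable_funX.
- apply: measurable_funM.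
    apply: measurable_funB => //; apply: measurableT_comp.
      by apply: continuous_measurable_fun; exact: continuous_cos.
    exact: measurable_funM.
  apply: measurable_funM.
    by apply: measurable_funD => //; exact: measurable_funX.
  by apply: measurable_funV; exact: measurable_funX.
Qed.

Lemma measurable_levy_kernel xi :
  measurable_fun [set: measurableTypeR R] (levy_kernel xi).
Proof.
have h : measurable_fun [set: measurableTypeR R]
    (fun t : measurableTypeR R => ((xi, t) : measurableTypeR R * measurableTypeR R)).
  exact: measurable_pair1.
exact: (measurableT_comp measurable_levy_kernel_pair h).
Qed.

Lemma integrable_levy_kernel (G : finmeasR R) xi :
  G.-integrable setT (EFin \o levy_kernel xi).
Proof.
apply: (@integrable_bounded _ _ _ _ _ _ _ _ (xi ^+ 2 + 2)) => //.
- exact: (fin_num_fun_lty (fin_num_measure G)).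
- exact: measurable_levy_kernel.
- by move=> t _; exact: levy_kernel_bound.
Qed.

Section laplace.
Variable b : R.
Hypothesis b_gt0 : 0 < b.

(** Tonelli's theorem: the kernel is negated to make the integrand nonnegative, and the half-line
    enters [f] as an indicator so that the integral runs over the whole product. *)
Lemma laplace_levy_integral (G : finmeasR R) :
  (\int[mu]_(x in `[0%R, +oo[)
     (expR (- b * x) * - \int[G]_t levy_kernel x t)%:E =
   \int[G]_t ((1 + t ^+ 2) / (b * (b ^+ 2 + t ^+ 2)))%:E)%E.
Proof.
pose f (p : measurableTypeR R * measurableTypeR R) : \bar R :=
  (\1_(`[0%R, +oo[%classic) p.1 * (expR (- b * p.1) * - levy_kernel p.1 p.2))%:E.
have mf : measurable_fun setT f.
  apply/measurable_EFinP; apply: measurable_funM.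
    apply: measurableT_comp; last exact: measurable_fst.
    by apply: measurable_indic.
  apply: measurable_funM.
    apply: measurableT_comp; last first.
      by apply: measurable_funM => //; exact: measurable_fst.
    exact: measurable_expR.
  by apply: measurable_funN; exact: measurable_levy_kernel_pair.
have f0 p : (0 <= f p)%E.
  by rewrite lee_fin mulr_ge0// mulr_ge0 ?expR_ge0// oppr_ge0 levy_kernel_le0.
have := @fubini_tonelli _ _ _ _ R mu G f mf f0.
have -> : (\int[mu]_x \int[G]_y f (x, y) = \int[mu]_(x in `[0%R, +oo[)
     (expR (- b * x) * - \int[G]_t levy_kernel x t)%:E)%E.
  rewrite [RHS]integral_mkcond; apply: eq_integral => x _.
  rewrite patchE /f/= indicE; case: ifPn => x0; last first.
    by under eq_integral do rewrite mul0r; rewrite integral0.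
  under eq_integral do rewrite mul1r mulrN -mulNr EFinM.
  rewrite integralZl//; last exact: integrable_levy_kernel.
  rewrite mulrN -mulNr EFinM /Rintegral fineK//.
  by apply: integrable_fin_num => //; exact: integrable_levy_kernel.
move=> ->; apply: eq_integral => t _.
rewrite -laplace_levy_kernel// [RHS]integral_mkcond; apply: eq_integral => x _.
by rewrite patchE /f/= indicE; case: ifPn => _; rewrite ?mul1r ?mul0r.
Qed.

End laplace.

(** These integrals are what the R-transform sees at z = - s. With b = 1 / sqrt s, 1 + s t^2 is (b^2
    + t^2) / b^2, so each one is a multiple of the Laplace transform at b of the Levy exponent. *)
Lemma levy_measure_unique (G G' : finmeasR R) (s : R) : 0 < s ->
  (forall xi, \int[G]_t levy_kernel xi t = \int[G']_t levy_kernel xi t) ->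
  \int[G]_t ((1 + t ^+ 2) / (1 + s * t ^+ 2)) =
  \int[G']_t ((1 + t ^+ 2) / (1 + s * t ^+ 2)).
Proof.
move=> s0 GG'; pose b := (Num.sqrt s)^-1.
have b0 : 0 < b by rewrite invr_gt0 sqrtr_gt0.
have bs : b ^- 2 = s by rewrite /b exprVn invrK sqr_sqrtr// ltW.
have st t : 0 < 1 + s * t ^+ 2 by rewrite ltr_pwDl// mulr_ge0 ?sqr_ge0// ltW.
have E (g : finmeasR R) : \int[g]_t ((1 + t ^+ 2) / (b * (b ^+ 2 + t ^+ 2))) =
    b ^- 3 * \int[g]_t ((1 + t ^+ 2) / (1 + s * t ^+ 2)).
  rewrite -RintegralZl//.
    apply: eq_Rintegral => t _.
    have -> : 1 + s * t ^+ 2 = (b ^+ 2 + t ^+ 2) / b ^+ 2.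
      by rewrite mulrDl divff ?gt_eqF ?exprn_gt0// bs [s * _]mulrC.
    have bt : b ^+ 2 + t ^+ 2 != 0 by rewrite gt_eqF// ltr_pwDl ?exprn_gt0 ?sqr_ge0.
    by field; rewrite bt gt_eqF.
  apply: (@integrable_bounded _ _ _ _ _ _ _ _ (1 + s^-1)) => //.
  - exact: (fin_num_fun_lty (fin_num_measure g)).
  - apply: measurable_funM; first by apply: measurable_funD.
    apply: measurable_funV; apply: measurable_funD => //.
    by apply: measurable_funM => //; exact: measurable_funX.
  move=> t _; rewrite ger0_norm; last first.
    by apply: divr_ge0; [rewrite addr_ge0 ?sqr_ge0|rewrite ltW].
  rewrite ler_pdivrMr// (_ : (1 + s^-1) * _ = 1 + s * t ^+ 2 + s^-1 + t ^+ 2); last first.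
    by field; rewrite gt_eqF.
  have : 0 <= s * t ^+ 2 by rewrite mulr_ge0 ?sqr_ge0// ltW.
  have : 0 <= s^-1 by rewrite invr_ge0 ltW.
  by lra.
apply: (@mulfI _ (b ^- 3)); first by rewrite invr_neq0// expf_neq0// gt_eqF.
rewrite -!E; congr fine; rewrite -!laplace_levy_integral//.
by apply: eq_integral => x _; rewrite GG'.
Qed.

End levy_measure_unique.

(** * Restriction to the negative half-line *)

Section negative_axis.
Variable R : realType.

Lemma sector_germ_and (Q1 Q2 : R[i] -> Prop) :
  sector_germ Q1 -> sector_germ Q2 -> sector_germ (fun z => Q1 z /\ Q2 z).
Proof.
move=> g1 g2 alpha al; have [b1 b10 h1] := g1 _ al; have [b2 b20 h2] := g2 _ al.
exists (Num.min b1 b2); first by rewrite lt_min b10.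
move=> z [za /andP[z0]]; rewrite lt_min => /andP[zb1 zb2].
by split; [apply: h1|apply: h2]; split => //; rewrite z0.
Qed.

Lemma sector_germ_neg (Q : R[i] -> Prop) : sector_germ Q ->
  exists2 b : R, 0 < b & forall s, 0 < s < b -> Q (- s%:C).
Proof.
move=> gQ; have pi0 := pi_gt0 R.
have [|b b0 bQ] := gQ (pi / 2); first by apply/andP; split; lra.
exists b => // s /andP[s0 sb]; apply: bQ.
have ns : normc (- s%:C) = s by rewrite normcN normc_real gtr0_norm.
split; last by rewrite ns s0.
rewrite /carg ns /= oppr0 lexx mulNr divff ?gt_eqF// acosN1 subrr normr0.
by rewrite divr_gt0.
Qed.

Lemma Rintegral_odd (P : probR R) (f : R -> R) : symmetric_measure P ->
  measurable_fun [set: measurableTypeR R] f ->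
  P.-integrable setT (EFin \o f) -> (forall t, f (- t) = - f t) ->
  \int[P]_t f t = 0.
Proof.
move=> sP mf fi fN.
have E : \int[P]_t f t = \int[P]_t (-1 * f t).
  rewrite /Rintegral -(@integral_oppr _ P sP setT (EFin \o f))//=; last first.
    exact/measurable_EFinP.
  by congr fine; apply: eq_integral => t _; rewrite fN mulN1r.
by move: E; rewrite RintegralZl//; lra.
Qed.

(* Both square roots of [- w] give the same value: the odd part of the Cauchy
   kernel integrates to [0]. *)
Lemma Htransform_neg (P : probR R) (w : R) : symmetric_measure P -> 0 < w ->
  Htransform P (- w%:C) = - (\int[P]_t (w^-1 + t ^+ 2)^-1)%:C.
Proof.
move=> sP w0; pose k := (sqrtC (- w%:C : R[i]))^-1.
have wC0 : - w%:C != 0 :> R[i] by rewrite oppr_eq0 -normc_gt0 normc_real normr_gt0 gt_eqF.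
have sw0 : sqrtC (- w%:C) != 0 :> R[i] by rewrite sqrtC_eq0.
have kk : k ^+ 2 = - (w^-1)%:C by rewrite exprVn sqrtCK invrN fmorphV.
have Y0 : 0 < w^-1 by rewrite invr_gt0.
pose r (t : R) := (w^-1 + t ^+ 2)^-1.
have den t : 0 < w^-1 + t ^+ 2 by rewrite ltr_pwDl// sqr_ge0.
have r0 t : 0 < r t by rewrite invr_gt0.
have rw t : r t <= w.
  by rewrite -[leRHS]invrK lef_pV2 ?posrE// lerDl sqr_ge0.
have mr : measurable_fun [set: measurableTypeR R] r.
  by apply: measurable_funV; exact: measurable_funD.
have mtr : measurable_fun [set: measurableTypeR R] (fun t : measurableTypeR R => t * r t).
  exact: measurable_funM.
have tr t : `|t * r t| <= 1 + w.
  rewrite normrM (gtr0_norm (r0 t)) ler_pdivrMr// mulrDr mulrDl mulrDl !mul1r mulfV ?gt_eqF//.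
  have := sqr_ge0 t; have := sqr_ge0 (`|t| - 1).
  rewrite sqrrB real_normK ?num_real//.
  have : 0 <= w * t ^+ 2 by rewrite mulr_ge0 ?sqr_ge0// ltW.
  by lra.
have Pfin : (P setT < +oo)%E := fin_num_fun_lty (fin_num_measure P).
rewrite /Htransform /cauchy_transform -/k.
have -> : cintegral P (fun t => (k - t%:C)^-1) =
    Cintegral P setT (fun t => - k * (r t)%:C + (-1) * (t * r t)%:C).
  (* Since k^2 = - 1 / w, the kernel 1 / (k - t) = (k + t) / (k^2 - t^2) equals - (k + t) r(t), with
     even part - k r(t) and odd part - t r(t). *)
  apply: eq_Cintegral => t _.
  have kt : (k - t%:C) * (k + t%:C) = - (w^-1 + t ^+ 2)%:C.
    by rewrite -subr_sqr kk -rmorphXn -opprD -rmorphD.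
  have d0 : - (w^-1 + t ^+ 2)%:C != 0 :> R[i].
    by rewrite oppr_eq0 -normc_gt0 normc_real normr_gt0 gt_eqF.
  have k0 : k - t%:C != 0.
    by apply: contraNneq d0 => k0; rewrite -kt k0 mul0r.
  apply: (mulfI k0); rewrite mulfV// mulN1r rmorphM/= -mulNr -mulrDl -opprD.
  by rewrite mulrA mulrN kt opprK /r fmorphV mulfV// -oppr_eq0.
have mC (f : R -> R) : measurable_fun [set: measurableTypeR R] f ->
    @Cmeasurable _ (measurableTypeR R) _ setT (fun t => (f t)%:C).
  exact: Cmeasurable_real.
have mkC (f : R -> R) (z : R[i]) : measurable_fun [set: measurableTypeR R] f ->
    @Cmeasurable _ (measurableTypeR R) _ setT (fun t => z * (f t)%:C).
  by move=> mf; apply: CmeasurableM; [exact: Cmeasurable_cst|exact: mC].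
have br : @Cbounded _ (measurableTypeR R) _ setT (fun t => (r t)%:C).
  by exists w => t _; rewrite normc_real gtr0_norm.
have btr : @Cbounded _ (measurableTypeR R) _ setT (fun t => (t * r t)%:C).
  by exists (1 + w) => t _; rewrite normc_real.
have bZ (f : R -> R[i]) (z : R[i]) : @Cbounded _ (measurableTypeR R) _ setT f ->
    @Cbounded _ (measurableTypeR R) _ setT (fun t => z * f t).
  move=> [M fM]; exists (normc z * M) => t tT.
  by rewrite normcM ler_wpM2l ?normc_ge0// fM.
rewrite CintegralD//; [|exact: mkC|exact: bZ|exact: mkC|exact: bZ].
rewrite !CintegralZl//.
rewrite !Cintegral_real [X in _ + _ * X%:C]Rintegral_odd//; last 2 first.
- exact: (@probability_bounded_integrable _ _ _ _ _ (1 + w)).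
- by move=> t; rewrite /r sqrrN mulNr.
by rewrite rmorph0 mulr0 addr0 mulNr mulrN mulrA /k mulfV// mul1r.
Qed.

End negative_axis.

(** * The symmetric Poisson Levy measure *)

Section assembly.
Variables (R : realType) (c : R).
Hypothesis c_gt0 : 0 < c.

Definition has_poisson_levy (G : finmeasR R) :=
  forall A : set (measurableTypeR R), measurable A ->
    G A = ((c / 4)%:E * (\d_(1%R : R) A + \d_((-1)%R : R) A))%E.

Let c4_ge0 : 0 <= c / 4. Proof. by rewrite divr_ge0// ltW. Qed.

Lemma Rintegral_poisson_levy (G : finmeasR R) (f : R -> R) :
  has_poisson_levy G -> measurable_fun [set: measurableTypeR R] f ->
  \int[G]_t f t = c / 4 * (f 1 + f (- 1)).
Proof.
move=> hG mf.
have mEf : measurable_fun [set: measurableTypeR R] (EFin \o f) by exact/measurable_EFinP.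
pose d1 : {measure set (measurableTypeR R) -> \bar R} := \d_(1 : measurableTypeR R).
pose d2 : {measure set (measurableTypeR R) -> \bar R} := \d_(- 1 : measurableTypeR R).
have id a := integrable_dirac (a : measurableTypeR R) mf.
pose m := mscale (NngNum c4_ge0) (measure_add d1 d2).
transitivity (fine (\int[m]_t (f t)%:E)%E).
  congr fine; apply: eq_measure_integral => A mA _.
  rewrite -[RHS]/((c / 4)%:E * measure_add d1 d2 A)%E measure_addE.
  exact: hG.
have -> : (\int[m]_t (f t)%:E = (c / 4)%:E * ((f 1)%:E + (f (- 1))%:E))%E.
  rewrite /m integral_mscale//; last first.
    apply/integrableP; split => //.
    rewrite ge0_integral_measure_add//; last exact: measurableT_comp.
    by rewrite !integral_dirac//; [|exact: measurableT_comp..]; rewrite !diracT !mul1e -EFinD ltry.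
  rewrite integral_measure_add//; [|exact: id|exact: id].
  by rewrite !integral_dirac// !diracT !mul1e.
by rewrite -EFinD -EFinM.
Qed.

(** Both atoms have t^2 = 1, so the integral is (c / 4) times twice 2 / (1 - z). *)
Lemma poisson_levy_germ (G : finmeasR R) (z : R[i]) :
  has_poisson_levy G -> normc z < 1 ->
  z * cintegral G (fun t => (1 + t%:C ^+ 2) / (1 - z * t%:C ^+ 2)) =
  c%:C * z / (1 - z).
Proof.
move=> hG z1; pose f (t : R) : R[i] := (1 + t%:C ^+ 2) / (1 - z * t%:C ^+ 2).
have [mRe mIm] : @Cmeasurable _ (measurableTypeR R) _ setT f.
  have mt2 : @Cmeasurable _ (measurableTypeR R) R setT (fun t => t%:C ^+ 2).
    by under eq_fun do rewrite -rmorphXn; apply: Cmeasurable_real; exact: measurable_funX.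
  apply: CmeasurableM; first by apply: CmeasurableD => //; exact: Cmeasurable_cst.
  apply: CmeasurableV; apply: CmeasurableB; first exact: Cmeasurable_cst.
  by apply: CmeasurableM => //; exact: Cmeasurable_cst.
have -> : cintegral G f = (c / 4)%:C * (f 1 + f (- 1)).
  rewrite /cintegral !Rintegral_poisson_levy//.
  case: (f 1) => x y; case: (f (- 1)) => x' y' /=.
  by apply/eqP; rewrite eq_complex/= !mul0r subr0 addr0 !eqxx.
have z10 : 1 - z != 0.
  rewrite -normc_gt0 (lt_le_trans _ (normcB_ge _ _))//.
  by rewrite -[in normc 1](rmorph1 (real_complex R)) normc_real normr1 subr_gt0.
rewrite /f rmorphN sqrrN !rmorph1 expr1n mulr1 rmorphM fmorphV rmorph_nat /=.
by field.
Qed.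

End assembly.

(** * Identification of the law from its R-transform *)

Section uniqueness.
Variables (R : realType) (c : R).
Hypothesis c_gt0 : 0 < c.

(** At z = - s the R-transform is - c s / (1 + s), so h (- s) = - s / rho with rho = (1 + s - c s) /
    (1 + s). Then H (h z) = z is a Stieltjes identity at the point rho / s. It is applied to the
    unknown law as well as to the explicit one. *)
Lemma stieltjes_of_rect_Rtransform (P : probR R) (G : finmeasR R) :
  rect_Rtransform P (fun z => z * cintegral G
    (fun t => (1 + t%:C ^+ 2) / (1 - z * t%:C ^+ 2))) ->
  (forall s, 0 < s -> \int[G]_t ((1 + t ^+ 2) / (1 + s * t ^+ 2)) = c / (1 + s)) ->
  exists2 b : R, 0 < b & forall s, 0 < s < b ->
    \int[P]_t ((1 + s - c * s) / (s * (1 + s)) + t ^+ 2)^-1 = s.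
Proof.
move=> [sP [h [_ hz hH _] hf]] hG.
(* Any bound below 1 on |h z / z - 1| excludes h z = 0, where z / h z would be 0 by convention and
   could not be inverted. *)
have half0 : 0 < 2^-1 :> R by [].
have [b b0 hb] := sector_germ_neg (sector_germ_and (hz _ half0) (sector_germ_and hH hf)).
(* The bound s < 1 / c makes [rho] positive, so that h (- s) stays on the negative half-line. *)
exists (Num.min b c^-1); first by rewrite lt_min b0 invr_gt0.
move=> s /andP[s0]; rewrite lt_min => /andP[sb sc].
have cs1 : c * s < 1 by rewrite -ltr_pdivlMl// mulr1.
have [] := hb s _; first by rewrite s0.
move: (h _) => w nw [Hw fw].
have fE : - s%:C * cintegral G (fun t => (1 + t%:C ^+ 2) / (1 - (- s%:C) * t%:C ^+ 2)) =
    - (s * (c / (1 + s)))%:C.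
  rewrite mulNr -hG// [in RHS]rmorphM/= -Cintegral_real; congr (- (_ * _)).
  apply: eq_Cintegral => t _.
  by rewrite mulNr opprK rmorphM fmorphV !rmorphD rmorphXn rmorph1 rmorphM rmorphXn.
have sC0 : s%:C != 0 :> R[i] by rewrite -normc_gt0 normc_real normr_gt0 gt_eqF.
have s10 : 1 + s != 0 by rewrite gt_eqF// addr_gt0.
pose rho := (1 + s - c * s) / (1 + s).
have rho0 : 0 < rho by apply: divr_gt0; lra.
have rhoC : rho%:C != 0 :> R[i] by rewrite -normc_gt0 normc_real normr_gt0 gt_eqF.
have w0 : w != 0.
  apply: contraTneq nw => ->; rewrite mul0r sub0r normcN.
  by rewrite -[in normc 1](rmorph1 (real_complex R)) normc_real normr1 -leNgt; lra.
have wE : w = - (s / rho)%:C.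
  have e : - s%:C / w = rho%:C.
    apply/eqP; rewrite -(addrNK 1 (_ / w)) -fw fE -(rmorph1 (real_complex R)) -rmorphN -rmorphD.
    by apply/eqP; congr (_%:C); rewrite /rho; field.
  rewrite rmorphM fmorphV /= -e; move: (s%:C) sC0 => k k0.
  by field; rewrite w0 k0.
have sr0 : 0 < s / rho by rewrite divr_gt0.
move: Hw; rewrite wE Htransform_neg// => /oppr_inj/complexI.
rewrite invf_div => E; rewrite -[RHS]E; apply: eq_Rintegral => t _.
by congr (_ + _)^-1; rewrite /rho; field; rewrite s10 gt_eqF.
Qed.

(** The equation is Y s^2 + e s = 1 with e = Y - 1 + c, and s is its positive root. For Y >= 2 one
    has e >= Y / 2, hence s <= 2 / Y: large Y gives s in the range of the germs. *)
Lemma solve_stieltjes_argument (Y : R) : 2 <= Y ->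
  exists2 s, 0 < s <= 2 / Y & (1 + s - c * s) / (s * (1 + s)) = Y.
Proof.
move=> Y2; have Y0 : 0 < Y by lra.
pose e := Y - 1 + c; pose D := e ^+ 2 + 4 * Y.
have e0 : Y / 2 <= e by have := c_gt0; rewrite /e; lra.
have eg0 : 0 < e by rewrite (lt_le_trans _ e0)// divr_gt0.
have D0 : 0 <= D by rewrite addr_ge0 ?sqr_ge0// mulr_ge0// ltW.
pose s := (Num.sqrt D - e) / (2 * Y).
have sD : Num.sqrt D ^+ 2 = D by rewrite sqr_sqrtr.
have eD : e < Num.sqrt D.
  rewrite -ltr_sqr ?nnegrE ?sqrtr_ge0 ?(ltW eg0)// sD /D ltrDl.
  by rewrite mulr_gt0.
have s0 : 0 < s by rewrite divr_gt0 ?subr_gt0// mulr_gt0.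
have sE : Y * s ^+ 2 + e * s = 1.
  have -> : Y * s ^+ 2 + e * s = (Num.sqrt D ^+ 2 - e ^+ 2) / (4 * Y).
    by rewrite /s; field; rewrite gt_eqF.
  by rewrite sD /D; field; rewrite gt_eqF.
exists s.
  rewrite s0/= ler_pdivlMr//.
  have : Y / 2 * s <= e * s by rewrite ler_wpM2r// ltW.
  have : 0 <= Y * s ^+ 2 by rewrite mulr_ge0 ?sqr_ge0// ltW.
  by lra.
have s10 : s * (1 + s) != 0 by rewrite gt_eqF// mulr_gt0// addr_gt0.
apply: (mulIf s10); rewrite mulfVK//.
by move: sE; rewrite /e => sE; rewrite -{1}sE; ring.
Qed.

Lemma has_Pc_law_unique (P P0 : probR R) (G G' : finmeasR R) :
  has_poisson_levy c G -> has_Pc_law c P0 -> symmetric_measure P ->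
  (forall xi, \int[G']_t levy_kernel xi t = \int[G]_t levy_kernel xi t) ->
  rect_Rtransform P (fun z => z * cintegral G'
    (fun t => (1 + t%:C ^+ 2) / (1 - z * t%:C ^+ 2))) ->
  has_Pc_law c P.
Proof.
move=> hG hP0 sP GG' rP.
have hGs s : 0 < s -> \int[G]_t ((1 + t ^+ 2) / (1 + s * t ^+ 2)) = c / (1 + s).
  move=> s0; rewrite (Rintegral_poisson_levy c_gt0 hG).
    by rewrite sqrrN expr1n mulr1; field; rewrite gt_eqF// addr_gt0.
  apply: measurable_funM; first by apply: measurable_funD.
  apply: measurable_funV; apply: measurable_funD => //.
  by apply: measurable_funM => //; exact: measurable_funX.
have rP0 : rect_Rtransform P0 (fun z => z * cintegral G
    (fun t => (1 + t%:C ^+ 2) / (1 - z * t%:C ^+ 2))).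
  apply: (rect_Rtransform_Pc c_gt0 hP0); apply: (sector_germ_ball ltr01) => z /andP[_ z1].
  exact: poisson_levy_germ.
have [b0 b0_gt0 h0] := stieltjes_of_rect_Rtransform rP0 hGs.
have [|b b_gt0 h] := stieltjes_of_rect_Rtransform rP.
  by move=> s s0; rewrite (levy_measure_unique s0 GG') hGs.
pose m := Num.min b b0; have m0 : 0 < m by rewrite lt_min b_gt0.
(* Beyond this threshold Y >= 2, as the quadratic requires, and s <= 2 / Y < m, so both germ
   identities hold at the same s. *)
have Y0 : 0 < 2 + 2 / m by rewrite addr_gt0// divr_gt0.
suff st Y : 2 + 2 / m < Y -> \int[P]_t (Y + t ^+ 2)^-1 = \int[P0]_t (Y + t ^+ 2)^-1.
  move=> A mA.
  by rewrite (symmetric_stieltjes_unique Y0 st sP (Pc_symmetric hP0))// hP0.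
move=> hY; have m2 : 0 < 2 / m by rewrite divr_gt0.
have [|s /andP[s0 sY] <-] := @solve_stieltjes_argument Y; first by lra.
have sm : s < m.
  rewrite (le_lt_trans sY)// ltr_pdivrMr; last by lra.
  by rewrite mulrC -ltr_pdivrMr//; lra.
by move: sm; rewrite lt_min => /andP[sb sb0]; rewrite h ?s0// h0 ?s0.
Qed.

End uniqueness.

Theorem mainTheorem8 (R : realType) (c : R) (hc : 0 < c)
    (mu : probability (measurableTypeR R) R) (hmu : symmetric_poisson c mu) :
  (exists P : probability (measurableTypeR R) R, bercovici_pata0 mu P) /\
  (forall P : probability (measurableTypeR R) R, bercovici_pata0 mu P ->
     forall A : set (measurableTypeR R), measurable A ->
       P A = Pc_measure c A).
Proof.
have [G [hG [smu sG Gmu]]] := hmu.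
have [P0 hP0] := exists_Pc hc; split.
  exists P0, G; split=> //; split=> //; first exact: (boxplus0_infdiv_Pc hc hP0).
  apply: (rect_Rtransform_Pc hc hP0); apply: (sector_germ_ball ltr01) => z /andP[_ z1].
  exact: poisson_levy_germ.
move=> P [G' [[_ _ G'mu] [_ _ rP]]].
apply: (has_Pc_law_unique hc hG hP0 _ _ rP); first by case: rP.
(* Both Levy measures represent the characteristic function of [mu], so their exponents agree at
   every xi. *)
by move=> xi; apply: expR_inj; apply: complexI; exact: etrans (esym (G'mu xi)) (Gmu xi).
Qed.
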